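(* Let $\lambda$ be a regular infinite cardinal and let $Y$ be a $(\lambda,\aleph_0)$-adic compactum. Then the weight of $Y$ equals its $\pi$-character or the weight of $Y$ is less than $\lambda$; moreover, every uncountable regular cardinal $\ge\lambda$ is a caliber of $Y$.
   Context: A compactum is a compact Hausdorff space. Bases consist of nonempty open sets. A set is functionally open if it is a cozero set of a continuous real-valued function. $H(\theta)$ is the set of sets hereditarily of cardinality less than $\theta$, and $\theta$ always denotes a sufficiently large regular cardinal. For a compactum $X$ with topology $\mathcal{T}_X$ and an elementary submodel $M\prec(H(\theta),\in,\mathcal{T}_X)$, let $\pi^X_M\colon X\to X/M$ be the quotient map (with $X/M$ carrying the quotient topology) defined by declaring $\pi^X_M(p)\ne\pi^X_M(q)$ iff there are disjoint closed neighborhoods $U$ of $p$ and $V$ of $q$ with $U,V\in M$ (equivalently, iff some continuous real-valued function $h\in M$ on $X$ has $h(p)\neq h(q)$). Let $\lambda\ge\kappa$ be infinite cardinals. An $(M,\kappa)$-base of $X$ is a base of $X$ consisting only of functionally open sets $U$ for which $\pi^X_M[U]$ is the intersection of fewer than $\kappa$-many open subsets of $X/M$. A $(\lambda,\kappa)$-base of $X$ is a base $\mathcal{B}$ of $X$ that is an $(M,\kappa)$-base for all $M\prec(H(\theta),\in,\mathcal{B})$ satisfying $|M|\cap\lambda\subseteq M\cap\lambda\in\lambda+1$. $X$ is $(\lambda,\kappa)$-openly generated if it has a $(\lambda,\kappa)$-base. A compactum is $(\lambda,\kappa)$-adic if it is a continuous image of a $(\lambda,\kappa)$-openly generated compactum.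 The weight of a space is the least $\mu\ge\omega$ such that it has a base of size $\le\mu$. A local $\pi$-base at $p\in Y$ is a family of nonempty open sets such that every neighborhood of $p$ includes some member of the family. The $\pi$-character of a point $p$ is the least $\mu\ge\omega$ such that $p$ has a local $\pi$-base of size $\le\mu$; the $\pi$-character of $Y$ is the supremum of the $\pi$-characters of its points. A caliber of $Y$ is a regular cardinal $\nu$ such that every sequence of length $\nu$ of nonempty open subsets of $Y$ has a subsequence of length $\nu$ whose terms have a common point. *)

(* Defs.v *)
From HB Require Import structures.
From mathcomp Require Import all_boot all_order all_algebra.
From mathcomp Require Import all_classical all_reals all_analysis.
From Stdlib Require Import Relation_Operators Operators_Properties.
Set Implicit Arguments.
Unset Strict Implicit.
Unset Printing Implicit Defensive.
Import Order.TTheory GRing.Theory Num.Theory.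
Import numFieldNormedType.Exports.
Local Open Scope classical_set_scope.
Local Open Scope card_scope.
Local Open Scope ring_scope.
Local Open Scope quotient_scope.

(* The universe of sets: Aczel trees modulo extensional equality, so that     *)
(* Leibniz equality of zsets is equality of sets (see elts_inj). With the     *)
(* classical axioms of boolp this is a model of (second-order) ZFC.           *)

Inductive tree : Type := Tree (A : Type) (f : A -> tree).

Fixpoint tree_eq (x y : tree) : Prop :=
  match x, y with
  | Tree A f, Tree B g =>
      (forall a, exists b, tree_eq (f a) (g b)) /\
      (forall b, exists a, tree_eq (f a) (g b))
  end.

Definition tree_mem (x y : tree) : Prop :=
  match y with Tree B g => exists b, tree_eq x (g b) end.

Lemma tree_eq_refl x : tree_eq x x.
Proof. by elim: x => A f IH; split=> a; exists a. Qed.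

Lemma tree_eq_sym x y : tree_eq x y -> tree_eq y x.
Proof.
elim: x y => A f IH [B g] [fg gf]; split.
  by move=> b; have [a /IH] := gf b; exists a.
by move=> a; have [b /IH] := fg a; exists b.
Qed.

Lemma tree_eq_trans x y z : tree_eq x y -> tree_eq y z -> tree_eq x z.
Proof.
elim: x y z => A f IH [B g] [C h] [fg gf] [gh hg]; split.
  by move=> a; have [b fab] := fg a; have [c gbc] := gh b;
     exists c; exact: IH fab gbc.
by move=> c; have [b gbc] := hg c; have [a fab] := gf b;
   exists a; exact: IH fab gbc.
Qed.

HB.instance Definition _ := gen_eqMixin tree.
HB.instance Definition _ := gen_choiceMixin tree.

Definition tree_eqb : rel tree := fun x y => `[< tree_eq x y >].

Lemma tree_eqb_equiv : equiv_class_of tree_eqb.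
Proof.
split=> [x|x y|y x z]; first exact/asboolP/tree_eq_refl.
  by apply/asboolP/asboolP; exact: tree_eq_sym.
by move=> /asboolP xy /asboolP yz; apply/asboolP; exact: tree_eq_trans yz.
Qed.

Canonical tree_equiv := EquivRelPack tree_eqb_equiv.

Definition zset := {eq_quot tree_equiv}.

Definition elts (x : zset) : set zset := [set y | tree_mem (repr y) (repr x)].

Notation "x ∈ y" := (elts y x) (at level 70, no associativity).

Lemma pi_tree_eq (s t : tree) :
  (\pi_zset s = \pi_zset t :> zset) <-> tree_eq s t.
Proof. by split=> [/eqquotP/asboolP|st]; last exact/eqquotP/asboolP. Qed.

Lemma elts_inj : injective elts.
Proof.
move=> x y xy; rewrite -[x]reprK -[y]reprK; apply/pi_tree_eq.
have sub (s t : zset) : elts s = elts t -> forall z,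
    tree_mem z (repr s) -> tree_mem z (repr t).
  move=> st z; have zz : tree_eq (repr (\pi_zset z)) z.
    by apply/pi_tree_eq; rewrite reprK.
  move=> zs; have : elts s (\pi_zset z).
    rewrite /elts /=; case: (repr s) zs => A f [a za]; exists a.
    exact: tree_eq_trans zz za.
  rewrite st /elts /=; case: (repr t) => B g [b zb]; exists b.
  exact: tree_eq_trans (tree_eq_sym zz) zb.
have := sub _ _ xy; have := sub _ _ (esym xy).
case: (repr x) (repr y) => [A f] [B g] yx' xy'; split=> [a|b].
  exact: (xy' (f a) (ex_intro _ a (tree_eq_refl (f a)))).
have [a ba] : exists a, tree_eq (g b) (f a).
  exact: (yx' (g b) (ex_intro _ b (tree_eq_refl (g b)))).
by exists a; exact: tree_eq_sym.
Qed.

Lemma elts_pi (A : Type) (f : A -> tree) :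
  elts (\pi_zset (Tree f)) = range (fun a => \pi_zset (f a) : zset).
Proof.
have : tree_eq (repr (\pi_zset (Tree f))) (Tree f).
  by apply/pi_tree_eq; rewrite reprK.
rewrite /elts; case: (repr _) => B g [gf fg].
apply/seteqP; split=> y /=.
  move=> [b yb]; have [a ba] := gf b; exists a => //.
  rewrite -[y]reprK; apply/pi_tree_eq/tree_eq_sym.
  exact: tree_eq_trans yb ba.
move=> [a _ <-]; have [b ba] := fg a; exists b.
apply: tree_eq_trans (tree_eq_sym ba).
by apply/pi_tree_eq; rewrite reprK.
Qed.

(* Every small family of sets is the family of elements of a set. *)
Lemma elts_small (A : Type) (f : A -> zset) : exists x, elts x = range f.
Proof.
exists (\pi_zset (Tree (fun a => repr (f a)))); rewrite elts_pi.
by apply: eq_imagel => a _; rewrite reprK.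
Qed.

Lemma zset_ind (P : zset -> Prop) :
  (forall x, (forall y, y ∈ x -> P y) -> P x) -> forall x, P x.
Proof.
move=> IH x; rewrite -[x]reprK; elim: (repr x) => A f IHf.
by apply: IH => y; rewrite elts_pi => -[a _ <-]; exact: IHf.
Qed.

(* Von Neumann ordinals and cardinals. *)

Definition transitive_set (x : zset) := forall y, y ∈ x -> elts y `<=` elts x.

Definition is_ordinal (x : zset) :=
  transitive_set x /\ forall y, y ∈ x -> transitive_set y.

Definition card_lt T U (A : set T) (B : set U) := A #<= B /\ ~ (B #<= A).

Definition is_cardinal (k : zset) :=
  is_ordinal k /\ forall a, a ∈ k -> card_lt (elts a) (elts k).

Definition infinite_cardinal (k : zset) :=
  is_cardinal k /\ infinite_set (elts k).

Definition regular_cardinal (k : zset) :=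
  infinite_cardinal k /\
  forall A : set zset, A `<=` elts k -> card_lt A (elts k) ->
    exists2 b, b ∈ k & forall a, A a -> a ∈ b.

Definition tree_succ (x : tree) : tree :=
  match x with Tree A f => Tree (fun o : option A => oapp f x o) end.

Definition omega : zset :=
  \pi_zset (Tree (fun n : nat => iter n tree_succ (Tree (of_void tree)))).

Definition least_cardinal (P : zset -> Prop) (k : zset) :=
  [/\ infinite_cardinal k, P k &
      forall m, infinite_cardinal m -> P m -> elts k `<=` elts m].

(* H(theta): the sets whose transitive closure has size less than theta. *)
Definition Hset (theta : zset) : set zset :=
  [set x | card_lt [set y | clos_trans zset (fun u v => u ∈ v) y x]
                   (elts theta)].

(* First-order logic of the language with membership and one constant. *)

Inductive term := Var of nat | Cst.

Inductive formula :=
| FMem of term & term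
| FEq of term & term
| FBot
| FImp of formula & formula
| FAll of nat & formula.

Definition teval (c : zset) (e : nat -> zset) (t : term) : zset :=
  match t with Var n => e n | Cst => c end.

Definition upd (e : nat -> zset) (n : nat) (a : zset) : nat -> zset :=
  fun m => if m == n then a else e m.

Fixpoint sat (D : set zset) (c : zset) (e : nat -> zset) (f : formula) : Prop :=
  match f with
  | FMem s t => teval c e s ∈ teval c e t
  | FEq s t => teval c e s = teval c e t
  | FBot => False
  | FImp f g => sat D c e f -> sat D c e g
  | FAll n f => forall a, D a -> sat D c (upd e n a) f
  end.

Definition elem_submodel (M D : set zset) (c : zset) :=
  [/\ M `<=` D, M c &
      forall f (e : nat -> zset), (forall n, M (e n)) ->
        (sat M c e f <-> sat D c e f)].

(* A space living in the universe of sets is a topologicalType X with an      *)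
(* injection code : X -> zset whose range is a set; p is identified with      *)
(* code p, hence U : set X with the zset whose elements are the code p, p in  *)
(* U, and a family of subsets of X with a zset of such zsets.                 *)

Definition is_coding (X : Type) (code : X -> zset) :=
  injective code /\ exists x, elts x = range code.

Definition codes_set (X : Type) (code : X -> zset) (U : set X) (u : zset) :=
  elts u = code @` U.

Definition codes_family (X : Type) (code : X -> zset) (B : set (set X))
    (b : zset) :=
  elts b = [set u | exists2 U, B U & codes_set code U u].

Definition compactum (X : topologicalType) :=
  compact [set: X] /\ hausdorff_space X.

Definition ne_basis (X : topologicalType) (B : set (set X)) :=
  basis B /\ forall U, B U -> U !=set0.

Definition functionally_open (R : realType) (X : topologicalType)
    (U : set X) :=
  exists2 f : X -> R, continuous f & U = [set x | f x != 0].

Definition closed_nbhs_in (X : topologicalType) (code : X -> zset)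
    (M : set zset) (p : X) (U : set X) :=
  [/\ closed U, nbhs p U & exists2 u, M u & codes_set code U u].

Definition M_separated (X : topologicalType) (code : X -> zset)
    (M : set zset) (p q : X) :=
  exists U V : set X,
    [/\ closed_nbhs_in code M p U, closed_nbhs_in code M q V &
        U `&` V = set0].

(* For an elementary submodel M, non-separation is an equivalence relation;   *)
(* to have a quotient type for all M, we take the equivalence relation that   *)
(* it generates (see piME).                                                   *)
Definition M_equivb (X : topologicalType) (code : X -> zset)
    (M : set zset) : rel X :=
  fun p q => `[< clos_refl_sym_trans X
                   (fun x y => ~ M_separated code M x y) p q >].

Lemma M_equivb_equiv (X : topologicalType) (code : X -> zset) (M : set zset) :
  equiv_class_of (M_equivb code M).
Proof.
split=> [x|x y|y x z]; first exact/asboolP/rst_refl.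
  by apply/asboolP/asboolP; exact: rst_sym.
by move=> /asboolP xy /asboolP yz; apply/asboolP; exact: rst_trans yz.
Qed.

Definition M_equiv (X : topologicalType) (code : X -> zset) (M : set zset) :=
  EquivRelPack (M_equivb_equiv code M).

Definition M_quotient (X : topologicalType) (code : X -> zset)
    (M : set zset) : topologicalType :=
  quotient_topology {eq_quot M_equiv code M}.

Definition piM (X : topologicalType) (code : X -> zset) (M : set zset)
    (p : X) : M_quotient code M :=
  \pi_({eq_quot M_equiv code M}) p.

Lemma piME (X : topologicalType) (code : X -> zset) (M : set zset) :
  (forall p q r, ~ M_separated code M p q -> ~ M_separated code M q r ->
    ~ M_separated code M p r) ->
  forall p q, piM code M p <> piM code M q <-> M_separated code M p q.
Proof.
move=> tr p q.
have symS x y : M_separated code M x y -> M_separated code M y x.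
  by move=> [U [V [xU yV UV]]]; exists V, U; split; rewrite // setIC.
have E x y : clos_refl_sym_trans X (fun x y => ~ M_separated code M x y) x y ->
    ~ M_separated code M x y.
  elim=> {x y} [//|x [U [V [[_ xU _] [_ xV _] UV]]]|x y _ xy /symS //|].
    suff : (U `&` V) x by rewrite UV.
    by split; exact: nbhs_singleton.
  by move=> x y z _ xy _ yz; exact: tr xy yz.
split=> [pq|pq].
  apply: contrapT => npq; apply: pq; apply/eqquotP/asboolP; exact: rst_step.
by move=> /eqquotP/asboolP/E.
Qed.

Definition M_base (R : realType) (kappa : zset) (X : topologicalType)
    (code : X -> zset) (M : set zset) (B : set (set X)) :=
  ne_basis B /\
  forall U, B U ->
    functionally_open R U /\
    exists W : set (set (M_quotient code M)),
      [/\ card_lt W (elts kappa), W `<=` open &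
          piM code M @` U = \bigcap_(w in W) w].

(* |M| \cap lambda \subseteq M \cap lambda \in lambda + 1 *)
Definition good_trace (lambda : zset) (M : set zset) :=
  (exists mu, [/\ is_cardinal mu, elts mu #= M &
                  elts mu `&` elts lambda `<=` M `&` elts lambda]) /\
  (exists delta, (delta ∈ lambda \/ delta = lambda) /\
                 elts delta = M `&` elts lambda).

(* "theta sufficiently large": all regular theta beyond some cardinal. *)
Definition lk_base (R : realType) (lambda kappa : zset) (X : topologicalType)
    (code : X -> zset) (B : set (set X)) :=
  ne_basis B /\
  exists2 b, codes_family code B b &
    exists2 theta0, is_cardinal theta0 &
      forall theta, regular_cardinal theta -> theta0 ∈ theta ->
        forall M : set zset, elem_submodel M (Hset theta) b ->
          good_trace lambda M -> M_base R kappa code M B.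

Definition openly_generated (R : realType) (lambda kappa : zset)
    (X : topologicalType) :=
  exists2 code : X -> zset, is_coding code &
    exists B : set (set X), lk_base R lambda kappa code B.

Definition adic (R : realType) (lambda kappa : zset) (Y : topologicalType) :=
  exists X : topologicalType,
    [/\ compactum X, openly_generated R lambda kappa X &
        exists2 f : X -> Y, continuous f & range f = [set: Y]].

Definition is_weight (Y : topologicalType) : zset -> Prop :=
  least_cardinal (fun mu =>
    exists2 B : set (set Y), ne_basis B & B #<= elts mu).

Definition local_pi_base (Y : topologicalType) (p : Y) (B : set (set Y)) :=
  (forall U, B U -> open U /\ U !=set0) /\
  forall N, nbhs p N -> exists2 U, B U & U `<=` N.

Definition is_pi_character_at (Y : topologicalType) (p : Y) : zset -> Prop :=
  least_cardinal (fun mu =>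
    exists2 B : set (set Y), local_pi_base p B & B #<= elts mu).

(* The supremum is taken among infinite cardinals: it is omega if Y is empty. *)
Definition is_pi_character (Y : topologicalType) : zset -> Prop :=
  least_cardinal (fun mu =>
    forall (p : Y) chi, is_pi_character_at p chi -> elts chi `<=` elts mu).

Definition is_caliber (Y : topologicalType) (nu : zset) :=
  regular_cardinal nu /\
  forall U : zset -> set Y,
    (forall i, i ∈ nu -> open (U i) /\ U i !=set0) ->
    exists2 phi : zset -> zset,
      (forall i, i ∈ nu -> phi i ∈ nu) /\
      (forall i j, i ∈ nu -> j ∈ nu -> i ∈ j -> phi i ∈ phi j) &
      exists y, forall i, i ∈ nu -> U (phi i) y.

(* Main.v *)
Require Import Defs.
From mathcomp Require Import all_boot all_order all_algebra.
From mathcomp Require Import all_classical all_reals all_analysis.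
From Stdlib Require Import Relation_Operators Operators_Properties.
Set Implicit Arguments.
Unset Strict Implicit.
Unset Printing Implicit Defensive.
Local Open Scope classical_set_scope.
Local Open Scope card_scope.
Local Open Scope quotient_scope.

(* Let M be an elementary submodel with a good trace and SS the family of the
   subsets of X lying in M. For kappa = omega the hypothesis says that every U in
   the base B has an open saturation {x | x is not separated by SS from some u in
   U}. Elementarity is used only through closure properties of SS: M is built as
   a hull under Skolem functions and under finitely many further operations,
   chosen semantically, so that no set-theoretic formula is ever written.

   Caliber nu: shrink the given sets to F i in B, let d be the trace of M on nu.
   The saturation of F d contains a nonempty open V in SS, and every nonempty open
   subset of V in SS meets F d. If a maximal I such that V and the F i (i in I)
   have the finite intersection property were bounded, then I would be included
   in d and d could be added to I. So I is unbounded, and compactness applies.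

   Weight: let X' be a closed subset of X on which f is irreducible and onto Y. If
   M contains, for each nonempty open G in M, a local pi-base at some point of G
   as a subset, then points of X' not separated by SS have the same image, hence
   the open G with f^-1(G) in SS form a base of Y, of size at most |M|. Such an M
   exists with |M| at most the pi-character if the latter is at least lambda, and
   with |M| < lambda otherwise. *)

(** * Cardinal arithmetic *)

Lemma card_le_map T U (A : set T) (B : set U) (f : T -> U) :
  (forall a, A a -> B (f a)) ->
  (forall a b, A a -> A b -> f a = f b -> a = b) -> A #<= B.
Proof.
move=> fAB finj; have /card_esym : f @` A #= A.
  by apply: inj_card_eq => a b /set_mem Aa /set_mem Ab; exact: finj.
rewrite card_eq_le => /andP[+ _] => /card_le_trans; apply.
by apply: subset_card_le => _ [a Aa <-]; exact: fAB.
Qed.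

Lemma card_le_mapE T U (A : set T) (B : set U) (u0 : U) :
  A #<= B -> exists f : T -> U, (forall a, A a -> B (f a)) /\
    (forall a b, A a -> A b -> f a = f b -> a = b).
Proof.
move=> /card_leP[f].
have E a (Aa : A a) : A (val (SigSub (mem_set Aa))) by [].
pose g a := if pselect (A a) is left Aa then val (f (SigSub (mem_set Aa))) else u0.
exists g; split=> [a Aa|a b Aa Ab]; rewrite /g.
  by case: pselect => // Aa'; apply: set_valP.
case: pselect => // Aa'; case: pselect => // Ab' /val_inj /inj.
by rewrite !inE => /(_ I I)/(congr1 val).
Qed.

Lemma card_le_surj T U (A : set T) (B : set U) (f : T -> U) :
  (forall b, B b -> exists2 a, A a & f a = b) -> B #<= A.
Proof.
move=> fs; apply: card_le_trans (card_image_le f A).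
by apply: subset_card_le => b /fs[a Aa <-]; exists a.
Qed.

(** Zorn's lemma for partial injections: a maximal one is total on A or onto B, since otherwise a
    missing pair could be added. *)
Lemma card_le_total T U (A : set T) (B : set U) : A #<= B \/ B #<= A.
Proof.
pose P (G : set (T * U)) := [/\ G `<=` A `*` B,
  forall a b b', G (a, b) -> G (a, b') -> b = b' &
  forall a a' b, G (a, b) -> G (a', b) -> a = a'].
have [F FP Ft|G [[GAB Gf Gi] Gmax]] := @Zorn_bigcup (T * U)%type P.
  split=> [x [G FG Gx]|a b b' [G FG Gab] [H FH Hab]|a a' b [G FG Gab] [H FH Hab]].
  - by have [+ _ _] := FP _ FG; apply.
  - have [GH|HG] := Ft _ _ FG FH.
      by have [_ + _] := FP _ FH; apply; [exact: GH Gab|].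
    by have [_ + _] := FP _ FG; apply; [exact: Gab|exact: HG].
  - have [GH|HG] := Ft _ _ FG FH.
      by have [_ _] := FP _ FH; apply; [exact: GH Gab|].
    by have [_ _] := FP _ FG; apply; [exact: Gab|exact: HG].
have [[a0 Aa0 Ga0]|tot] := pselect (exists2 a, A a & forall b, ~ G (a, b)); last first.
  have [A0|/set0P[a1 Aa1]] := eqVneq A set0; first by left; rewrite A0 card_ge0.
  have Gt a : A a -> exists b, G (a, b).
    move=> Aa; apply: contrapT => nG; apply: tot; exists a => // b Gab.
    by apply: nG; exists b.
  have [b1 _] := Gt _ Aa1.
  have [f fG] : {f : T -> U & forall a, A a -> G (a, f a)}.
    apply: (@choice _ _ (fun a b => A a -> G (a, b))) => a.
    have [Aa|nAa] := pselect (A a); last by exists b1.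
    by have [b] := Gt _ Aa; exists b.
  left; apply: (card_le_map (f := f)) => [a /fG/GAB[]//|a b Aa Ab fab].
  by apply: Gi (fG _ Aa) _; rewrite fab; exact: fG.
have Gs b : B b -> exists a, G (a, b).
  move=> Bb; apply: contrapT => nG; apply: (Gmax (G `|` [set (a0, b)])).
    split=> [|s]; first exact: subsetUl.
    by apply: (Ga0 b); apply: s; right.
  split=> [x [/GAB//|->//]|a c c' [Gac|[ea ec]] [Gac'|[ea' ec']]|
           a c c' [Gac|[ea ec]] [Gac'|[ea' ec']]] //; subst => //.
  - exact: Gf Gac Gac'.
  - by case: (Ga0 _ Gac).
  - by case: (Ga0 _ Gac').
  - exact: Gi Gac Gac'.
  - by case: nG; exists a.
  - by case: nG; exists c.
right; have [f fG] : {f : U -> T & forall b, B b -> G (f b, b)}.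
  apply: (@choice _ _ (fun b a => B b -> G (a, b))) => b.
  have [Bb|nBb] := pselect (B b); last by exists a0.
  by have [a] := Gs _ Bb; exists a.
apply: (card_le_map (f := f)) => [b /fG/GAB[]//|a b Ba Bb fab].
by apply: Gf (fG _ Ba) _; rewrite fab; exact: fG.
Qed.

Lemma card_le_lt_trans T U V (A : set T) (B : set U) (C : set V) :
  A #<= B -> card_lt B C -> card_lt A C.
Proof.
move=> AB [BC nCB]; split; first exact: card_le_trans BC.
by move=> CA; apply: nCB; exact: card_le_trans CA AB.
Qed.

Lemma card_le_infinite T U (A : set T) (B : set U) :
  A #<= B -> infinite_set A -> infinite_set B.
Proof. by move=> AB /infiniteP nA; apply/infiniteP; exact: card_le_trans AB. Qed.

Lemma card_setX_le T U T' U' (A : set T) (B : set U) (A' : set T') (B' : set U') :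
  A #<= A' -> B #<= B' -> A `*` B #<= A' `*` B'.
Proof.
move=> AA BB; have [A0|/set0P[a0 Aa0]] := eqVneq A set0.
  by rewrite A0 set0X card_ge0.
have [B0|/set0P[b0 Bb0]] := eqVneq B set0; first by rewrite B0 setX0 card_ge0.
have inh S S' (C : set S) (D : set S') c : C c -> C #<= D -> exists d, D d.
  move=> Cc CD; apply: contrapT => nD.
  have : C #<= @set0 S'.
    apply: card_le_trans CD _; apply: subset_card_le => d Dd.
    by case: nD; exists d.
  by move=> /card_le0P C0; rewrite C0 in Cc.
have [a1 _] := inh _ _ _ _ _ Aa0 AA; have [b1 _] := inh _ _ _ _ _ Bb0 BB.
have [f [fA fi]] := card_le_mapE a1 AA; have [g [gB gi]] := card_le_mapE b1 BB.
apply: (card_le_map (f := fun p => (f p.1, g p.2))).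
  by move=> [a b] [/= /fA ? /gB ?].
move=> [a b] [a' b'] [/= Aa Bb] [/= Aa' Bb'] [/(fi _ _ Aa Aa') -> /(gi _ _ Bb Bb') ->].
by [].
Qed.

Definition square_dom T (G : set (T * T * T)) : set T :=
  [set a | exists c, G (a, a, c)].

(* G is the graph of an injection from the square of a subset S of A into S. *)
Definition square_inj T (A : set T) (G : set (T * T * T)) :=
  [/\ square_dom G `<=` A,
   forall a b c, G (a, b, c) ->
     [/\ square_dom G a, square_dom G b & square_dom G c],
   forall a b, square_dom G a -> square_dom G b -> exists c, G (a, b, c),
   forall a b c c', G (a, b, c) -> G (a, b, c') -> c = c' &
   forall a b a' b' c, G (a, b, c) -> G (a', b', c) -> a = a' /\ b = b'].

Lemma square_inj_bigcup T (A : set T) (F : set (set (T * T * T))) :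
  F `<=` square_inj A -> total_on F subset -> square_inj A (\bigcup_(G in F) G).
Proof.
move=> FP Ft.
have FE a : square_dom (\bigcup_(G in F) G) a -> exists2 G, F G & square_dom G a.
  by move=> [c [G FG Gac]]; exists G => //; exists c.
have Fs G : F G -> square_dom G `<=` square_dom (\bigcup_(G in F) G).
  by move=> FG a [c Gc]; exists c, G.
have F2 G H : F G -> F H -> exists K, [/\ F K, G `<=` K & H `<=` K].
  by move=> FG FH; have [s|s] := Ft _ _ FG FH; [exists H|exists G]; split.
have dS (G H : set (T * T * T)) : G `<=` H -> square_dom G `<=` square_dom H.
  by move=> GH a [c Gc]; exists c; exact: GH.
split=> [a /FE[G FG Ga]|a b c [G FG Gabc]|a b /FE[G FG Ga] /FE[H FH Hb]|
         a b c c' [G FG Gabc] [H FH Habc]|a b a' b' c [G FG Gabc] [H FH Habc]].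
- have [GA _ _ _ _] := FP _ FG; exact: GA.
- have [_ /(_ _ _ _ Gabc)[? ? ?] _ _ _] := FP _ FG.
  by split; apply: Fs FG _ _.
- have [K [FK GK HK]] := F2 _ _ FG FH.
  have [_ _ /(_ a b (dS _ _ GK _ Ga) (dS _ _ HK _ Hb))[c Kc] _ _] := FP _ FK.
  by exists c, K.
- have [K [FK GK HK]] := F2 _ _ FG FH.
  by have [_ _ _ + _] := FP _ FK; apply; [exact: GK Gabc|exact: HK].
- have [K [FK GK HK]] := F2 _ _ FG FH.
  by have [_ _ _ _] := FP _ FK; apply; [exact: GK Gabc|exact: HK].
Qed.

Lemma card_setXX T (A : set T) : infinite_set A -> A `*` A #<= A.
Proof.
move=> /[dup] Ainf /infinite_setN0[a0 _].
have [i [iA ii]] := card_le_mapE a0 ((infiniteP A).1 Ainf).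
have {ii}ii : injective i by move=> m n; exact: ii.
(* The pairing of natural numbers, transported to a countable subset of A. Keeping [G0] inside the
   maximal graph puts all [i m] into S, where they serve as tags. *)
pose G0 : set (T * T * T) :=
  [set x | exists m n, x = (i m, i n, i (pickle (m, n)))].
have G0d a : square_dom G0 a <-> exists m, a = i m.
  split=> [[c [m [n [-> _ _]]]]|[m ->]]; first by exists m.
  by exists (i (pickle (m, m))), m, m.
have G0g : square_inj A G0.
  split=> [a /G0d[m ->]|a b c [m [n [-> -> ->]]]|a b /G0d[m ->] /G0d[n ->]|
    a b c c' [m [n [-> -> ->]]] [m' [n' [/ii -> /ii -> ->]]]|
    a b a' b' c [m [n [-> -> ->]]] [m' [n' [-> ->]]]] //.
  - exact: iA.
  - by split; apply/G0d; eexists.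
  - by exists (i (pickle (m, n))), m, n.
  - by move=> /ii/(pcan_inj pickleK)[-> ->].
(* Zorn's lemma is applied to the G for which [G0]|[G] is good, so that the empty chain is covered
   and the maximal graph contains [G0]. *)
have [F FP Ft|G [GG Gmax]] :=
    @Zorn_bigcup _ (fun G => square_inj A (G0 `|` G)).
  have [->|/set0P[H0 FH0]] := eqVneq F set0; first by rewrite bigcup_set0 setU0.
  have -> : G0 `|` \bigcup_(X in F) X = \bigcup_(X in [set G0 `|` Y | Y in F]) X.
    apply/seteqP; split=> x.
      case=> [G0x|[H FH Hx]]; first by exists (G0 `|` H0); [exists H0|left].
      by exists (G0 `|` H); [exists H|right].
    by case=> _ [H FH <-] [G0x|Hx]; [left|right; exists H].
  apply: square_inj_bigcup => [_ [H FH <-]|_ _ [H FH <-] [K FK <-]].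
    exact: FP.
  by have [s|s] := Ft _ _ FH FK; [left|right]; apply: setUS.
have {}Gmax H : square_inj A H -> G0 `|` G `<=` H -> H `<=` G0 `|` G.
  move=> Hg GH; apply: contrapT => nHG; apply: (Gmax H).
    split; first by move=> x Gx; apply: GH; right.
    by move=> HG; apply: nHG => x /HG ?; right.
  suff -> : G0 `|` H = H by [].
  by apply/seteqP; split=> [x [G0x|//]|x]; [apply: GH; left|right].
have G0G : G0 `<=` G0 `|` G by exact: subsetUl.
move: (G0 `|` G) GG Gmax G0G => {}G [GA Gd Gt Gf Gi] Gmax G0G.
set S := square_dom G in GA Gd Gt *.
have Si m : S (i m) by exists (i (pickle (m, m))); apply: G0G; exists m, m.
have [g gG] : {g : T * T -> T & forall p, S p.1 -> S p.2 -> G (p, g p)}.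
  apply: (@choice _ _ (fun p c => S p.1 -> S p.2 -> G (p, c))) => -[a b].
  have [[Sa Sb]|nS] := pselect (S a /\ S b); last by exists a0 => Sa Sb; case: nS.
  by have [c] := Gt _ _ Sa Sb; exists c.
have gS a b : S a -> S b -> S (g (a, b)).
  by move=> Sa Sb; have [] := Gd _ _ _ (gG (a, b) Sa Sb).
have gi a b a' b' : S a -> S b -> S a' -> S b' ->
    g (a, b) = g (a', b') -> a = a' /\ b = b'.
  move=> Sa Sb Sa' Sb' E; apply: Gi (gG (a, b) Sa Sb) _.
  by rewrite E; exact: (gG (a', b')).
have SS : S `*` S #<= S.
  apply: (card_le_map (f := g)) => [[a b] [/= ? ?]|]; first exact: (gS).
  move=> [a b] [a' b'] [/= ? ?] [/= ? ?] /gi.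
  by case=> // -> ->.
have [AS|SA] := card_le_total (A `\` S) S.
  suff AlS : A #<= S.
    apply: card_le_trans (card_le_trans SS (subset_card_le GA)).
    exact: card_setX_le.
  have [h [hS hi]] := card_le_mapE a0 AS.
  apply: (card_le_map (f := fun a => if pselect (S a) is left _ then g (i 0%N, a)
                                     else g (i 1%N, h a))).
    move=> a Aa; case: pselect => Sa; first exact: (gS).
    by apply: (gS) => //; apply: hS.
  move=> a b Aa Ab; case: pselect => Sa; case: pselect => Sb.
  - by move=> /gi[].
  - by move=> /gi[] //; [exact: hS|move=> /ii].
  - by move=> /gi[] //; [exact: hS|move=> /ii].
  - by move=> /gi[]; [|exact: hS| |exact: hS| ] => // _ /hi; apply.
have [h [hS hi]] := card_le_mapE a0 SA.
have hA s : S s -> A (h s) by move=> /hS[].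
have hnS s : S s -> ~ S (h s) by move=> /hS[].
pose V : set T := S `|` h @` S.
(* The new pairs are coded by a tag among i 0, i 1, i 2 and two elements of S. *)
pose new : set (T * T * T) := [set x |
  exists s t, S s /\ S t /\
    (x = (s, h t, h (g (i 0%N, g (s, t)))) \/
     x = (h s, t, h (g (i 1%N, g (s, t)))) \/
     x = (h s, h t, h (g (i 2%N, g (s, t)))))].
have GS a b c : G (a, b, c) -> [/\ S a, S b & S c] by exact: Gd.
have newP a b c : new (a, b, c) -> [/\ V a, V b, ~ (S a /\ S b) & exists2 s, S s & c = h s].
  move=> [s [t [Ss [St []]]]].
    move=> [-> -> ->]; split; [by left|by right; exists t|by case=> _; apply: hnS|].
    by exists (g (i 0%N, g (s, t))) => //; apply: (gS) => //; exact: (gS).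
  case=> -[-> -> ->].
    split; [by right; exists s|by left|by case=> + _; apply: hnS|].
    by exists (g (i 1%N, g (s, t))) => //; apply: (gS) => //; exact: (gS).
  split; [by right; exists s|by right; exists t|by case=> + _; apply: hnS|].
  by exists (g (i 2%N, g (s, t))) => //; apply: (gS) => //; exact: (gS).
have domE a : square_dom (G `|` new) a <-> V a.
  split=> [[c [/GS[? _ _]|/newP[]//]]|]; first by left.
  case=> [Sa|[s Ss <-]].
    by have [c Gc] := Gt _ _ Sa Sa; exists c; left.
  by exists (h (g (i 2%N, g (s, s)))); right; exists s, s; do !split=> //; right; right.
have ne : square_inj A (G `|` new).
  split=> [a /domE[/GA//|[s Ss <-]]|a b c|a b /domE Va /domE Vb|
      a b c c'|a b a' b' c].
  - exact: hA.
  - case=> [/GS[? ? ?]|/newP[Va Vb _ [s Ss ->]]].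
      by split; apply/domE; left.
    by split; apply/domE => //; right; exists s.
  - case: Va Vb => [Sa|[s Ss <-]] [Sb|[t St <-]].
    + by have [c Gc] := Gt _ _ Sa Sb; exists c; left.
    + by exists (h (g (i 0%N, g (a, t)))); right; exists a, t; do !split=> //; left.
    + by exists (h (g (i 1%N, g (s, b)))); right; exists s, b; do !split=> //; right; left.
    + by exists (h (g (i 2%N, g (s, t)))); right; exists s, t; do !split=> //; right; right.
  - case=> [Gc|nc] [Gc'|nc'].
    + exact: Gf Gc Gc'.
    + by have [Sa Sb _] := GS _ _ _ Gc; have [_ _ []] := newP _ _ _ nc'.
    + by have [Sa Sb _] := GS _ _ _ Gc'; have [_ _ []] := newP _ _ _ nc.
    + case: nc => s [t [Ss [St E]]]; case: nc' => s' [t' [Ss' [St' E']]].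
      case: E E' => [|[|]] [-> -> ->] [|[|]] [].
      * by move=> -> /(hi _ _ St St') -> ->.
      * by move=> ss; case: (hnS _ Ss'); rewrite -ss.
      * by move=> ss; case: (hnS _ Ss'); rewrite -ss.
      * by move=> ss; case: (hnS _ Ss); rewrite ss.
      * by move=> /(hi _ _ Ss Ss') -> -> ->.
      * by move=> _ tt; case: (hnS _ St'); rewrite -tt.
      * by move=> ss; case: (hnS _ Ss); rewrite ss.
      * by move=> _ tt; case: (hnS _ St); rewrite tt.
      * by move=> /(hi _ _ Ss Ss') -> /(hi _ _ St St') -> ->.
  - case=> [Gc|nc] [Gc'|nc'].
    + exact: Gi Gc Gc'.
    + have [_ _ Sc] := GS _ _ _ Gc; have [_ _ _ [s Ss cs]] := newP _ _ _ nc'.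
      by case: (hnS _ Ss); rewrite -cs.
    + have [_ _ Sc] := GS _ _ _ Gc'; have [_ _ _ [s Ss cs]] := newP _ _ _ nc.
      by case: (hnS _ Ss); rewrite -cs.
    + case: nc => s [t [Ss [St E]]]; case: nc' => s' [t' [Ss' [St' E']]].
      have gh k k' : h (g (i k, g (s, t))) = h (g (i k', g (s', t'))) ->
          [/\ k = k', s = s' & t = t'].
        move=> /hi H; have /gi : g (i k, g (s, t)) = g (i k', g (s', t')).
          by apply: H; apply: (gS) => //; exact: (gS).
        case=> //; [exact: (gS)|exact: (gS)|move=> /ii -> /gi].
        by case.
      by case: E E' => [|[|]] [-> -> ->] [|[|]] [-> ->] /gh[] // _ -> ->.
(* Maximality would put the new triples into G, but their coordinates of the form [h s] lie outside
   S. *)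
have GnewG := Gmax _ ne (@subsetUl _ _ _).
have : (G `|` new) (h (i 0%N), h (i 0%N), h (g (i 2%N, g (i 0%N, i 0%N)))).
  by right; exists (i 0%N), (i 0%N); do !split=> //; right; right.
by move=> /GnewG/GS[/(hnS _ (Si _))].
Qed.

Lemma card_nat_le T (A : set T) : infinite_set A -> [set: nat] #<= A.
Proof. by move=> /infiniteP. Qed.

Lemma card_bigcup_le T U I (D : set I) (F : I -> set T) (A : set U) :
  infinite_set A -> D #<= A -> (forall i, D i -> F i #<= A) ->
  \bigcup_(i in D) F i #<= A.
Proof.
move=> Ai DA FA; apply: card_le_trans (card_setXX Ai).
have [a0 _] := infinite_setN0 Ai.
have [D0|/set0P[i0 Di0]] := eqVneq D set0; first by rewrite D0 bigcup_set0 card_ge0.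
have [d [dA di]] := card_le_mapE a0 DA.
have [e eP] : {e : I -> T -> U & forall i, D i -> (forall x, F i x -> A (e i x)) /\
    (forall x y, F i x -> F i y -> e i x = e i y -> x = y)}.
  apply: (@choice _ _ (fun i e => D i -> (forall x, F i x -> A (e x)) /\
    (forall x y, F i x -> F i y -> e x = e y -> x = y))) => i.
  have [Di|nDi] := pselect (D i); last by exists (fun=> a0).
  by have [e eP] := card_le_mapE a0 (FA _ Di); exists e.
have [j jP] : {j : T -> I & forall x, (\bigcup_(i in D) F i) x -> D (j x) /\ F (j x) x}.
  apply: (@choice _ _ (fun x j => (\bigcup_(i in D) F i) x -> D j /\ F j x)) => x.
  have [[i Di Fi]|nx] := pselect ((\bigcup_(i in D) F i) x); last by exists i0.
  by exists i.
apply: (card_le_map (f := fun x => (d (j x), e (j x) x))).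
  by move=> x /jP[Dj Fj]; split; [exact: dA|have [+ _] := eP _ Dj; apply].
move=> x y /jP[Dx Fx] /jP[Dy Fy] [/(di _ _ Dx Dy) jxy].
rewrite -jxy in Dy Fy *; have [_ ei] := eP _ Dx; exact: ei.
Qed.

Lemma card_setU_le T U (A B : set T) (C : set U) :
  infinite_set C -> A #<= C -> B #<= C -> A `|` B #<= C.
Proof.
move=> Ci AC BC; have -> : A `|` B = \bigcup_(b in [set: bool]) (if b then A else B).
  by apply/seteqP; split=> [x [Ax|Bx]|x [[] _ ?]]; [exists true|exists false|left|right].
apply: card_bigcup_le => // [|[]//].
apply: card_le_trans (card_nat_le Ci).
by apply: (card_le_map (f := nat_of_bool)) => // -[] [].
Qed.

(** Folding a pairing function is injective on lists of a given length; the length is recorded as a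
    further component. *)
Lemma card_seqT_le T : infinite_set [set: T] -> [set: seq T] #<= [set: T].
Proof.
move=> /[dup] Ti /infinite_setN0[t0 _].
have [g [_ gi]] := card_le_mapE t0 (card_setXX Ti).
have [i [_ ii]] := card_le_mapE t0 (card_nat_le Ti).
pose code := foldr (fun x y => g (x, y)) t0.
have codeI s t : size s = size t -> code s = code t -> s = t.
  elim: s t => [|x s IH] [|y t] //= [st] E.
  have [-> /IH ->//] := gi (x, code s) (y, code t) (conj I I) (conj I I) E.
apply: (card_le_map (f := fun s => g (i (size s), code s))) => // s t _ _ E.
by have [/ii st /codeI->//] := gi (_, _) (_, _) (conj I I) (conj I I) E; exact: st.
Qed.

(** * Small sets and von Neumann ordinals *)

Definition small (S : set zset) := exists x, elts x = S.

Lemma small_elts x : small (elts x).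
Proof. by exists x. Qed.
#[local] Hint Resolve small_elts : core.

Lemma smallP (S : set zset) :
  small S -> exists (A : Type) (f : A -> zset), S = range f.
Proof.
case=> x <-; rewrite -[x]reprK; case: (repr x) => A f.
by exists A, (fun a => \pi_zset (f a) : zset); rewrite elts_pi.
Qed.

Lemma small_subset (S T : set zset) : small T -> S `<=` T -> small S.
Proof.
move=> /smallP[A [f ->]] ST.
have [x xE] := elts_small (fun a : {a : A | S (f a)} => f (sval a)).
exists x; rewrite xE; apply/seteqP; split=> [_ [[a Sa] _ <-]//|y Sy].
have [a _ fa] := ST _ Sy; rewrite -fa in Sy.
by exists (exist _ a Sy).
Qed.

Lemma small_image (f : zset -> zset) (S : set zset) : small S -> small (f @` S).
Proof.
move=> /smallP[A [g ->]]; have [x xE] := elts_small (f \o g).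
by exists x; rewrite xE image_comp.
Qed.

(** Replacement and union: the branches of trees chosen for the members are collected in a sigma
    type, which indexes a tree for the union. *)
Lemma small_bigcup (D : set zset) (F : zset -> set zset) :
  small D -> (forall i, D i -> small (F i)) -> small (\bigcup_(i in D) F i).
Proof.
move=> /smallP[A [g ->]] sF.
have [h hE] : {h : A -> zset & forall a, elts (h a) = F (g a)}.
  by apply: (@choice _ _ (fun a x => elts x = F (g a))) => a; apply: sF; exists a.
(* [B a] is the branching type of the tree chosen for [F (g a)], and [k a] enumerates the elements
   along it. *)
pose B a := let: Tree B _ := repr (h a) in B.
pose k a : B a -> zset :=
  match repr (h a) as t return (let: Tree B _ := t in B) -> zset with
  | Tree B f => fun b => \pi_zset (f b) end.
have kE a : range (k a) = F (g a).
  rewrite -hE -[in RHS](reprK (h a)) /k /B.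
  by case: (repr (h a)) => C f; rewrite elts_pi.
have [x xE] := elts_small (fun p : {a : A & B a} => k (projT1 p) (projT2 p)).
exists x; rewrite xE; apply/seteqP; split=> [_ [[a b] _ <-]|y [_ [a _ <-]]].
  by exists (g a); [exists a|rewrite -kE; exists b].
by rewrite -kE => -[b _ <-]; exists (existT _ a b).
Qed.

Lemma small_set1 x : small [set x].
Proof.
by have [y yE] := elts_small (fun _ : unit => x); exists y; rewrite yE;
   apply/seteqP; split=> [_ [_ _ <-]//|_ ->]; exists tt.
Qed.
#[local] Hint Resolve small_set1 : core.

Lemma small_setU (S T : set zset) : small S -> small T -> small (S `|` T).
Proof.
move=> [x <-] [y <-].
have [z zE] := elts_small (fun b : bool => if b then x else y).
have -> : elts x `|` elts y = \bigcup_(w in elts z) elts w.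
  rewrite zE; apply/seteqP; split=> [w [xw|yw]|w [_ [[] _ <-] ?]].
  - by exists x => //; exists true.
  - by exists y => //; exists false.
  - by left.
  - by right.
exact: small_bigcup.
Qed.

(** Every subset of [range f] is the image of a predicate on the index type, and such predicates can
    index a tree again. *)
Lemma small_powerset (S : set zset) : small S -> small [set z | elts z `<=` S].
Proof.
move=> sS; have [A [f fE]] := smallP sS.
have [h hE] : {h : (A -> Prop) -> zset & forall B : A -> Prop, elts (h B) = f @` B}.
  apply: (@choice _ _ (fun (B : A -> Prop) x => elts x = f @` B)) => B.
  by apply: (small_subset sS); rewrite fE => _ [a _ <-]; exists a.
have [x xE] := elts_small h; exists x; rewrite xE; apply/seteqP; split.
  by move=> _ [B _ <-] y /=; rewrite hE fE => -[a _ <-]; exists a.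
move=> z zS; exists (fun a => f a ∈ z) => //; apply: elts_inj; rewrite hE.
apply/seteqP; split=> [_ [a /= za <-]//|y zy].
by have := zS _ zy; rewrite fE => -[a _ fa]; exists a => //=; rewrite fa.
Qed.

Lemma mem_wf : well_founded (fun y x : zset => y ∈ x).
Proof. by move=> x; elim/zset_ind: x => x IH; constructor. Qed.

Lemma mem_irr (x : zset) : ~ x ∈ x.
Proof. by elim/zset_ind: x => x IH xx; exact: (IH x). Qed.

Lemma mem_rec (T : Type) (t0 : T) (step : zset -> (zset -> T) -> T) :
  (forall x f g, (forall y, y ∈ x -> f y = g y) -> step x f = step x g) ->
  exists F, forall x, F x = step x F.
Proof.
move=> stepE.
(* [t0] fills in the values outside x, on which [step x] does not depend. *)
pose G x (rec : forall y, y ∈ x -> T) :=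
  step x (fun y => if pselect (y ∈ x) is left h then rec y h else t0).
exists (Fix mem_wf (fun=> T) G) => x; rewrite Fix_eq.
  by apply: stepE => y yx; case: pselect.
move=> y f g fg; apply: stepE => z zy.
by case: pselect.
Qed.

Lemma ord_elt a b : is_ordinal a -> b ∈ a -> is_ordinal b.
Proof.
move=> [ta tta] ba; split; first exact: tta.
by move=> y yb; apply: tta; exact: (ta b).
Qed.

(** Double induction. If no element of a equals or contains b, and none of b equals or contains a,
    the induction hypotheses give both inclusions, so a = b by extensionality. *)
Lemma ord_trichotomy a b :
  is_ordinal a -> is_ordinal b -> [\/ a ∈ b, a = b | b ∈ a].
Proof.
elim/zset_ind: a b => a IHa; elim/zset_ind => b IHb oa ob.
have [[a' a'a [<-|ba']]|na] :=
    pselect (exists2 a', a' ∈ a & a' = b \/ b ∈ a').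
- by constructor 3.
- by constructor 3; case: oa => /(_ _ a'a) + _; apply.
have [[b' b'b [<-|ab']]|nb] := pselect (exists2 b', b' ∈ b & b' = a \/ a ∈ b').
- by constructor 1.
- by constructor 1; case: ob => /(_ _ b'b) + _; apply.
constructor 2; apply: elts_inj; apply/seteqP; split=> [a' a'a|b' b'b].
  have [//|E|ba'] := IHa _ a'a _ (ord_elt oa a'a) ob.
    by case: na; exists a'; [|left].
  by case: na; exists a'; [|right].
have [ab'|E|//] := IHb _ b'b oa (ord_elt ob b'b).
  by case: nb; exists b'; [|right].
by case: nb; exists b'; [|left].
Qed.

Lemma ord_sub a b : is_ordinal b -> a ∈ b -> elts a `<=` elts b.
Proof. by case=> tb _; exact: tb. Qed.

Lemma ord_subE a b : is_ordinal a -> is_ordinal b ->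
  elts a `<=` elts b -> a ∈ b \/ a = b.
Proof.
move=> oa ob ab; have [|->|/ab/mem_irr//] := ord_trichotomy oa ob; first by left.
by right.
Qed.

Lemma ord_nsub a b : is_ordinal a -> is_ordinal b ->
  ~ elts b `<=` elts a -> a ∈ b.
Proof.
move=> oa ob nab; have [//|E|ba] := ord_trichotomy oa ob.
  by case: nab; rewrite E.
by case: nab; exact: ord_sub.
Qed.

Lemma ord_least (P : zset -> Prop) : (exists2 a, is_ordinal a & P a) ->
  exists a, [/\ is_ordinal a, P a &
    forall b, is_ordinal b -> P b -> elts a `<=` elts b].
Proof.
case=> a; elim/zset_ind: a => a IH oa Pa.
have [[b [ba ob Pb]]|nb] := pselect (exists b, [/\ b ∈ a, is_ordinal b & P b]).
  exact: IH ba ob Pb.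
exists a; split=> // b ob Pb; apply: contrapT => nab.
by apply: nb; exists b; split=> //; exact: ord_nsub.
Qed.

Lemma ord_of_set (S : set zset) : small S -> (forall x, S x -> is_ordinal x) ->
  (forall x y, S x -> y ∈ x -> S y) -> exists2 a, is_ordinal a & elts a = S.
Proof.
case=> a <- So St; exists a => //; split=> [y ya z zy|y ya].
  exact: St ya zy.
by have [] := So _ ya.
Qed.

Lemma ord_sup (S : set zset) : small S -> (forall x, S x -> is_ordinal x) ->
  exists2 a, is_ordinal a & elts a = S `|` \bigcup_(x in S) elts x.
Proof.
move=> sS So; apply: ord_of_set.
- by apply: small_setU => //; exact: small_bigcup.
- by move=> x [/So//|[y /So oy /(ord_elt oy)]].
- move=> x y [Sx yx|[z Sz xz yx]]; right; first by exists x.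
  by exists z => //; exact: (ord_sub (So _ Sz) xz).
Qed.

(** * Cardinals, their successors and omega *)

Lemma card_eqP_le T U (A : set T) (B : set U) : A #<= B -> B #<= A -> A #= B.
Proof. by move=> AB BA; rewrite card_eq_le AB BA. Qed.

Lemma card_eq_leW T U (A : set T) (B : set U) : A #= B -> A #<= B.
Proof. by rewrite card_eq_le => /andP[]. Qed.

(** Transfinite recursion picks at each ordinal an element of S not yet used, and [None] once S is
    exhausted. The ordinals at which an element is picked form the required ordinal. *)
Lemma ord_equipotent (S : set zset) :
  small S -> exists2 a, is_ordinal a & elts a #= S.
Proof.
move=> sS.
pose used (F : zset -> option zset) a := [set x | exists2 b, b ∈ a & F b = Some x].
pose step a (F : zset -> option zset) :=
  if pselect (exists x, S x /\ ~ used F a x) is left h then Some (projT1 (cid h))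
  else None.
have [|F FE] := @mem_rec _ None step.
  move=> a f g fg; rewrite /step; suff -> : used f a = used g a by [].
  by apply/seteqP; split=> x [b ba fb]; exists b => //; rewrite -fb fg.
have FS a x : F a = Some x -> S x /\ ~ used F a x.
  rewrite FE /step; case: pselect => // h [<-].
  exact: (projT2 (cid h)).
have FN a : F a = None -> S `<=` used F a.
  rewrite FE /step; case: pselect => // nh _ x Sx; apply: contrapT => nx.
  by apply: nh; exists x.
have Fi a b x : is_ordinal a -> is_ordinal b -> F a = Some x -> F b = Some x -> a = b.
  move=> oa ob Fa Fb; have [ab|//|ba] := ord_trichotomy oa ob.
    by have [_ []] := FS _ _ Fb; exists a.
  by have [_ []] := FS _ _ Fa; exists b.
pose O := [set a | is_ordinal a /\ F a <> None].
(* G inverts F on ordinals; so O is included in the image of S under G and cannot be a proper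
   class. *)
have [G GE] : {G : zset -> zset & forall x, (exists2 a, is_ordinal a & F a = Some x) ->
    is_ordinal (G x) /\ F (G x) = Some x}.
  apply: (@choice _ _ (fun x a => (exists2 a, is_ordinal a & F a = Some x) ->
    is_ordinal a /\ F a = Some x)) => x.
  have [[a oa Fa]|] := pselect (exists2 a, is_ordinal a & F a = Some x); last by exists x.
  by exists a.
have sO : small O.
  apply: (small_subset (small_image G sS)) => a [oa].
  case Fa : (F a) => [x|//] _; exists x; first by have [] := FS _ _ Fa.
  have [|oG FG] := GE x; first by exists a.
  exact: Fi FG Fa.
have [||a oa aO] := ord_of_set sO.
- by move=> x [].
- move=> x y [ox nFx] yx; split; first exact: ord_elt yx.
  move=> /FN Sy; case Fx : (F x) nFx => [u|//] _.
  have [/Sy[b yb Fb] nu] := FS _ _ Fx.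
  by apply: nu; exists b => //; exact: ord_sub yb.
(* Otherwise a would belong to O, that is, to itself. *)
have Fa : F a = None.
  by case Fa : (F a) => //; case: (@mem_irr a); rewrite [in X in X a]aO; split=> //; rewrite Fa.
exists a => //; apply: card_eqP_le.
  apply: (card_le_map (f := fun b => odflt b (F b))) => [b|b c]; rewrite aO.
    by move=> [_]; case Fb : (F b) => [x|//] _ /=; have [] := FS _ _ Fb.
  move=> [ob +] [oc]; case Fb : (F b) => [x|//] _; case Fc : (F c) => [y|//] _ /= xy.
  by rewrite -xy in Fc; exact: Fi Fb Fc.
apply: (card_le_surj (f := fun b => odflt b (F b))) => x Sx.
by have [b ba Fb] := FN _ Fa _ Sx; exists b => //; rewrite Fb.
Qed.

Lemma cardinal_ord k : is_cardinal k -> is_ordinal k. Proof. by case. Qed.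

Lemma cardinal_equipotent (S : set zset) :
  small S -> exists2 k, is_cardinal k & elts k #= S.
Proof.
move=> /ord_equipotent[a oa aS].
have [|k [ok Sk kl]] := @ord_least (fun k => S #<= elts k).
  by exists a => //; apply: card_eq_leW; exact: card_esym.
exists k; last first.
  apply: card_eqP_le => //; apply: card_le_trans (card_eq_leW aS).
  apply/subset_card_le/kl => //.
  by apply: card_eq_leW; exact: card_esym.
split=> // b bk; split; first exact/subset_card_le/ord_sub.
move=> kb; have /(_ _ bk) := kl b (ord_elt ok bk) (card_le_trans Sk kb).
exact: mem_irr.
Qed.

Lemma cardinal_sub k a : is_cardinal k -> is_ordinal a ->
  elts k #<= elts a -> elts k `<=` elts a.
Proof.
move=> [ok ck] oa ka; apply: contrapT => nka.
by have [] := ck _ (ord_nsub oa ok nka).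
Qed.

Lemma least_cardinal_exists (P : zset -> Prop) :
  (exists2 k, infinite_cardinal k & P k) -> exists k, least_cardinal P k.
Proof.
case=> k ik Pk.
have [|m [om [im Pm] ml]] := @ord_least (fun k => infinite_cardinal k /\ P k).
  by exists k => //; case: ik => -[].
exists m; split=> // n [[on cn] fn] Pn.
by apply: ml.
Qed.

Lemma cantor (S : set zset) : small S -> ~ ([set z | elts z `<=` S] #<= S).
Proof.
(* The diagonal set d below collects the values [g z] with [g z] not in z; [g d] is then in d iff it
   is not. *)
move=> sS /(card_le_mapE omega)[g [gS gi]].
have [|d dE] := @small_subset
    [set x | exists z, [/\ elts z `<=` S, g z = x & ~ x ∈ z]] S sS.
  by move=> _ [z [/gS + <-]].
have dS : elts d `<=` S by rewrite dE => _ [z [/gS + <-]].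
have nd : ~ g d ∈ d.
  move=> /[dup]; rewrite [X in X _ -> _]dE => -[z [zS /gi zd gz]].
  by rewrite -zd in gz *.
by have := nd; rewrite [X in ~ X _]dE; apply; exists d.
Qed.

(* The successor of k, obtained as the least ordinal not embedding in k. *)
Lemma regular_above k : infinite_cardinal k ->
  exists2 t, regular_cardinal t & k ∈ t.
Proof.
move=> [ck ik]; have ok := cardinal_ord ck.
have [p op pE] := ord_equipotent (small_powerset (small_elts k)).
have [|t [ot tk tl]] := @ord_least (fun a => ~ (elts a #<= elts k)).
  exists p => // pk; apply: (cantor (small_elts k)).
  by apply: card_le_trans pk; apply: card_eq_leW; exact: card_esym.
have tltk a : a ∈ t -> elts a #<= elts k.
  move=> ta; apply: contrapT => nak.
  exact: (@mem_irr a (tl _ (ord_elt ot ta) nak _ ta)).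
have kt : k ∈ t.
  by apply: ord_nsub => // /subset_card_le.
exists t => //; split.
  split; last by apply: card_le_infinite ik; exact/subset_card_le/ord_sub.
  split=> // a ta; split; first exact/subset_card_le/ord_sub.
  by move=> /card_le_trans/(_ (tltk _ ta)).
move=> A At [_ ntA].
have sA := small_subset (small_elts t) At.
have [a ca aA] := cardinal_equipotent sA.
have {}ta : a ∈ t.
  apply: ord_nsub (cardinal_ord ca) ot _ => /subset_card_le ta.
  by apply: ntA; apply: card_le_trans ta (card_eq_leW aA).
have Ak : A #<= elts k.
  apply: card_le_trans (tltk _ ta); apply: card_eq_leW; exact: card_esym.
(* A has at most |k| elements, each of size at most |k|; so the supremum b has size at most |k| and
   lies below t. *)
have [b ob bE] := ord_sup sA (fun x Ax => ord_elt ot (At _ Ax)).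
exists b; last by move=> x Ax; rewrite bE; left.
apply: ord_nsub => // /subset_card_le tb; apply: tk.
apply: card_le_trans tb _; rewrite bE; apply: card_setU_le => //.
by apply: card_bigcup_le => // x /At/tltk.
Qed.

Lemma elts_tree_succ (x : tree) :
  elts (\pi_zset (tree_succ x)) = elts (\pi_zset x) `|` [set \pi_zset x : zset].
Proof.
case: x => A f; rewrite !elts_pi; apply/seteqP; split=> [_ [[a|] _ <-]|_ [[a _ <-]|->]].
- by left; exists a.
- by right.
- by exists (Some a).
- by exists None.
Qed.

Lemma card_omega : elts omega #= [set: nat].
Proof.
pose N n : zset := \pi_zset (iter n tree_succ (Tree (of_void tree))).
have oE : elts omega = range N by rewrite /omega elts_pi.
have NN m n : m < n -> N m ∈ N n.
  elim: n => // n IH; rewrite ltnS leq_eqVlt /N /= elts_tree_succ.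
  by move=> /orP[/eqP ->|/IH]; [right|left].
apply: card_eqP_le; rewrite oE; first exact: card_image_le.
apply: (card_le_map (f := N)) => [n _|m n _ _ E]; first by exists n.
by case: (ltngtP m n) => // /NN; rewrite E => /mem_irr.
Qed.

Lemma card_lt_omega T (W : set T) : card_lt W (elts omega) -> finite_set W.
Proof.
move=> [_ nW]; apply: contrapT => /infiniteP iW; apply: nW.
exact: card_le_trans (card_eq_leW card_omega) iW.
Qed.

(** * Transitive closures and H(theta) *)

Definition tc (z : zset) := [set y | clos_trans zset (fun u v => u ∈ v) y z].

Lemma tcP y z : tc z y <-> y ∈ z \/ exists2 w, w ∈ z & tc w y.
Proof.
split=> [/clos_trans_tn1_iff|[yz|[w wz wy]]].
- case=> [|w]; first by left.
  by move=> x wx /clos_trans_tn1_iff yw; right; exists w.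
- exact: t_step.
- by apply: t_trans wy _; exact: t_step.
Qed.

Lemma small_tc z : small (tc z).
Proof.
elim/zset_ind: z => z IH.
have -> : tc z = elts z `|` \bigcup_(w in elts z) tc w.
  by apply/seteqP; split=> y; [move=> /tcP|move=> yz; apply/tcP].
by apply: small_setU => //; exact: small_bigcup.
Qed.

Lemma tc_trans x y z : tc y x -> tc z y -> tc z x.
Proof. exact: t_trans. Qed.

(* To put several sets into H(theta) at once, gather them into one set z. *)
Lemma large_regular (k0 z : zset) : is_cardinal k0 ->
  exists t, [/\ regular_cardinal t, k0 ∈ t &
    forall y, elts y `<=` tc z -> Hset t y].
Proof.
move=> ck0.
(* k is at least as large as [k0], omega and the transitive closure of z; any regular t above it
   will do. *)
have [k ck kE] := cardinal_equipotent
  (small_setU (small_setU (small_elts k0) (small_elts omega)) (small_tc z)).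
have kU A : A `<=` elts k0 `|` elts omega `|` tc z -> A #<= elts k.
  move=> AU; apply: card_le_trans (subset_card_le AU) _.
  by apply: card_eq_leW; exact: card_esym.
have ik : infinite_cardinal k.
  split=> //; apply: (@card_le_infinite _ _ (elts omega)).
    by apply: kU => x ?; left; right.
  apply/infiniteP; apply: card_eq_leW; apply: card_esym; exact: card_omega.
have [t tr kt] := regular_above ik.
have ot : is_ordinal t by case: tr => -[[]].
have ktlt : card_lt (elts k) (elts t) by case: tr => -[[_ /(_ _ kt)]].
exists t; split=> // [|y yz].
  apply: ord_nsub => //; first exact: cardinal_ord.
  move=> /subset_card_le tk0; case: ktlt => _; apply.
  by apply: card_le_trans tk0 _; apply: kU => x ?; left; left.
apply: card_le_lt_trans ktlt; apply: kU => x /= xy; right.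
have [/yz//|[w /yz wz xw]] := (tcP x y).1 xy.
exact: tc_trans xw wz.
Qed.

(** * Elementary submodels *)

Fixpoint all_in (M : set zset) (s : seq zset) : Prop :=
  if s is x :: s' then M x /\ all_in M s' else True.

(** Arguments come as a finite list, so one sequence of operations covers all arities. The guard
    [D (op k s)] allows arbitrary values outside D. *)
Definition closed_ops (D : set zset) (op : nat -> seq zset -> zset)
    (M : set zset) :=
  forall k s, all_in M s -> D (op k s) -> M (op k s).

Lemma all_in_mkseq (M : set zset) e n :
  (forall k, M (e k)) -> all_in M (mkseq e n).
Proof. by move=> Me; rewrite /mkseq; elim: (iota 0 n) => //= k s IH. Qed.

(** The hull consists of the values of terms: finite trees with leaves in A and nodes labelled by
    the number of an operation. Over an infinite A there are only |A| of them. *)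
Lemma hull_exists (D A : set zset) (c : zset) (op : nat -> seq zset -> zset) :
  A `<=` D -> A c -> infinite_set A ->
  exists M, [/\ A `<=` M, M `<=` D, closed_ops D op M & M #<= A].
Proof.
move=> AD Ac Ai; pose T := {x : zset | A x}.
(* Values outside D are replaced by c, so that every term has a value in D. *)
pose guard x := if pselect (D x) is left _ then x else c.
pose fix interp (t : GenTree.tree T) : zset :=
  match t with
  | GenTree.Leaf x => sval x
  | GenTree.Node n f => guard (op n (map interp f)) end.
have TA : [set: T] #<= A.
  apply: (card_le_map (f := fun x : T => sval x)) => [[]//|[x Ax] [y Ay] _ _ /= xy].
  by subst y; congr exist; exact: Prop_irrelevance.
have Ti : infinite_set [set: T].
  apply: card_le_infinite Ai.
  apply: (card_le_surj (f := fun x : T => sval x)) => x Ax.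
  by exists (exist _ x Ax).
exists (range interp); split.
- by move=> x Ax; exists (GenTree.Leaf (exist _ x Ax)).
- move=> _ [[[x Ax]|n f] _ <-] /=; first exact: AD.
  by rewrite /guard; case: pselect => // _; exact: AD.
- move=> k s sM Dk.
  have [f sf] : exists f, s = map interp f.
    elim: s sM {Dk} => [|x s IH] /=; first by exists [::].
    by move=> [[t _ <-] /IH[f ->]]; exists (t :: f).
  rewrite sf in Dk *; exists (GenTree.Node k f) => //=; rewrite /guard; case: pselect => //.
(* Terms embed in lists over [nat + T] through the encoding of [GenTree], and these are counted by
   [card_seqT_le]. *)
- apply: card_le_trans TA.
  apply: card_le_trans (card_image_le _ _) _.
  have natT : [set: nat + T] #<= [set: T].
    have t0 : T by exists c.
    have [i [_ i_inj]] := card_le_mapE t0 (card_nat_le Ti).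
    have ii m n : i m = i n -> m = n by exact: i_inj.
    apply: card_le_trans (card_setXX Ti).
    apply: (card_le_map (f := fun x : nat + T => match x with
      inl n => (i 0, i n) | inr t => (i 1, t) end)) => // -[m|t] [n|u] _ _ [].
    + by move=> /ii ->.
    + by move=> /ii.
    + by move=> /ii.
    + by move=> ->.
  have iN : infinite_set [set: nat + T].
    apply: card_le_infinite Ti.
    by apply: (card_le_map (f := inr)) => // x y _ _ [].
  apply: card_le_trans natT; apply: card_le_trans (card_seqT_le iN).
  apply: (card_le_map (f := @GenTree.encode T)) => // s t _ _.
  exact: (pcan_inj (@GenTree.codeK T)).
Qed.

(** Embedding formulas into the countable type [GenTree.tree nat] numbers them, and thereby their
    Skolem functions. [Leaf 0] is reserved for the constant. *)
Definition tree_of_term (t : term) : GenTree.tree nat :=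
  if t is Var n then GenTree.Leaf n.+1 else GenTree.Leaf 0.

Fixpoint tree_of_formula (f : formula) : GenTree.tree nat :=
  match f with
  | FMem s t => GenTree.Node 0 [:: tree_of_term s; tree_of_term t]
  | FEq s t => GenTree.Node 1 [:: tree_of_term s; tree_of_term t]
  | FBot => GenTree.Node 2 [::]
  | FImp g h => GenTree.Node 3 [:: tree_of_formula g; tree_of_formula h]
  | FAll n g => GenTree.Node 4 [:: GenTree.Leaf n; tree_of_formula g]
  end.

Lemma tree_of_term_inj : injective tree_of_term.
Proof. by move=> [m|] [n|] //= [->]. Qed.

Lemma tree_of_formula_inj : injective tree_of_formula.
Proof.
elim=> [s t|s t||g IHg h IHh|m g IHg] [s' t'|s' t'||g' h'|n g'] //=.
- by move=> [/tree_of_term_inj -> /tree_of_term_inj ->].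
- by move=> [/tree_of_term_inj -> /tree_of_term_inj ->].
- by move=> [/IHg -> /IHh ->].
- by move=> [-> /IHg ->].
Qed.

Definition term_bound (t : term) := if t is Var n then n.+1 else 0.

Fixpoint formula_bound (f : formula) : nat :=
  match f with
  | FMem s t | FEq s t => maxn (term_bound s) (term_bound t)
  | FBot => 0
  | FImp g h => maxn (formula_bound g) (formula_bound h)
  | FAll _ g => formula_bound g
  end.

(** Truth depends on a finite initial segment of the environment, so a Skolem function can take that
    segment as its argument list. *)
Lemma sat_ext D c e e' f :
  (forall n, n < formula_bound f -> e n = e' n) -> sat D c e f <-> sat D c e' f.
Proof.
have teE t E E' : (forall n, n < term_bound t -> E n = E' n) ->
    teval c E t = teval c E' t by case: t => //= n; exact.
elim: f e e' => [s t|s t||g IHg h IHh|n g IHg] e e' /= E.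
- by rewrite !(teE _ _ _ (fun n lt => E n (leq_trans lt _))) ?leq_maxl ?leq_maxr.
- by rewrite !(teE _ _ _ (fun n lt => E n (leq_trans lt _))) ?leq_maxl ?leq_maxr.
- by [].
- by rewrite (IHg e e') ?(IHh e e') // => n lt; apply: E; rewrite leq_max lt ?orbT.
- have U a m : m < formula_bound g -> upd e n a m = upd e' n a m.
    by rewrite /upd; case: eqP => // _ /E.
  by split=> H a Da; apply/(IHg _ _ (U a)); exact: H.
Qed.

(** The Tarski-Vaught test, stated for universal quantifiers: the Skolem function of [FAll n g]
    returns a counterexample to g in D whenever there is one. *)
Lemma skolem_ops (D : set zset) (c : zset) : exists op, forall M,
  M `<=` D -> M c -> closed_ops D op M -> elem_submodel M D c.
Proof.
(* The list s is read as an environment, continued by the constant c. *)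
pose bad (fn : nat * formula) s a :=
  D a /\ ~ sat D c (upd (nth c s) fn.1 a) fn.2.
pose code (fn : nat * formula) := pickle (fn.1, tree_of_formula fn.2).
have codeI : injective code.
  by move=> [m g] [n h] /(pcan_inj pickleK)[-> /tree_of_formula_inj ->].
have [op opE] : {op : nat * seq zset -> zset & forall p fn, code fn = p.1 ->
    (exists a, bad fn p.2 a) -> bad fn p.2 (op p)}.
  apply: (@choice _ _ (fun p b => forall fn, code fn = p.1 ->
    (exists a, bad fn p.2 a) -> bad fn p.2 b)) => -[k s].
  have [[fn [fk [a ba]]]|nfn] :=
      pselect (exists fn, code fn = k /\ exists a, bad fn s a).
    by exists a => fn' /= fk' _; rewrite (codeI fn' fn) // fk.
  by exists c => fn fk ex; case: nfn; exists fn.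
exists (fun k s => op (k, s)) => M MD Mc Mop; split=> //.
elim=> [s t|s t||g IHg h IHh|n g IHg] e Me //=; first by rewrite IHg // IHh.
have Mupd a : M a -> forall m, M (upd e n a m).
  by move=> Ma m; rewrite /upd; case: eqP.
split=> H a; last by move=> Ma; apply/(IHg _ (Mupd _ Ma))/H/MD.
(* A counterexample in D yields one in M by closure; the induction hypothesis for g turns it into a
   counterexample to truth in M. *)
apply: contraPP => nsat Da.
pose s := mkseq e (formula_bound g).
have updE b : sat D c (upd (nth c s) n b) g <-> sat D c (upd e n b) g.
  apply: sat_ext => m lt; rewrite /upd; case: eqP => // _.
  by rewrite nth_mkseq.
have [|Db nb] := opE (code (n, g), s) (n, g) erefl.
  by exists a; split=> // /updE.
have Mb : M (op (code (n, g), s)).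
  by apply: Mop => //; exact: all_in_mkseq.
by apply: nb; apply/updE/(IHg _ (Mupd _ Mb)); exact: H.
Qed.

(** With this a single hull is closed under the Skolem functions and under further operations. *)
Definition interleave (op1 op2 : nat -> seq zset -> zset) k :=
  if odd k then op1 k./2 else op2 k./2.

Lemma closed_ops_interleave D op1 op2 M : closed_ops D (interleave op1 op2) M ->
  closed_ops D op1 M /\ closed_ops D op2 M.
Proof.
move=> Mop; split=> k s sM.
  by have := Mop k.*2.+1 s sM; rewrite /interleave /= odd_double /= uphalf_double.
by have := Mop k.*2 s sM; rewrite /interleave odd_double doubleK.
Qed.

Lemma elem_hull (D A : set zset) (c : zset) (op : nat -> seq zset -> zset) :
  A `<=` D -> A c -> infinite_set A ->
  exists M, [/\ elem_submodel M D c, closed_ops D op M, A `<=` M & M #<= A].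
Proof.
move=> AD Ac Ai; have [sk skP] := skolem_ops D c.
have [M [AM MD /closed_ops_interleave[Msk Mop] MA]] :=
  hull_exists (interleave sk op) AD Ac Ai.
by exists M; split=> //; apply: skP => //; exact: AM.
Qed.


(** * Submodels with a good trace *)

Lemma card_le_small (S T : set zset) : small T -> S #<= T -> small S.
Proof.
move=> sT /(card_le_mapE omega)[f [fT fi]].
have [g gE] : {g : zset -> zset & forall x, S x -> g (f x) = x}.
  have [g gE] : {g : zset -> zset & forall y, (exists2 x, S x & f x = y) ->
      S (g y) /\ f (g y) = y}.
    apply: (@choice _ _ (fun y x => (exists2 x, S x & f x = y) -> S x /\ f x = y)) => y.
    have [[x Sx fx]|] := pselect (exists2 x, S x & f x = y); last by exists y.
    by exists x.
  exists g => x Sx; have [|Sg fg] := gE (f x); first by exists x.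
  exact: fi.
apply: (small_subset (small_image g sT)) => x Sx.
by exists (f x); [exact: fT|exact: gE].
Qed.

Lemma ord_max_in nu a b : is_ordinal nu -> a ∈ nu -> b ∈ nu ->
  exists2 c, c ∈ nu & elts a `<=` elts c /\ elts b `<=` elts c.
Proof.
move=> on an bn; have oa := ord_elt on an; have ob := ord_elt on bn.
have [ab|->|ba] := ord_trichotomy oa ob.
- by exists b => //; split=> //; exact: ord_sub.
- by exists b; [|split].
- by exists a => //; split=> //; exact: ord_sub.
Qed.

Lemma omega_infinite : infinite_set (elts omega).
Proof.
by apply/infiniteP/card_eq_leW; apply: card_esym; exact: card_omega.
Qed.

(** One step of the construction in [elem_trace]: d dominates a bound of the trace, given by
    regularity, the cardinality of M, and omega. *)
Lemma card_lt_regular_ord nu (M : set zset) : regular_cardinal nu -> omega ∈ nu ->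
  card_lt M (elts nu) -> exists d, [/\ d ∈ nu, infinite_set (elts d),
    M `&` elts nu `<=` elts d & M #<= elts d].
Proof.
move=> [[[on cn] inu] nur] wn Mn.
have [|b bn bM] := nur (M `&` elts nu) (@subIsetr _ _ _).
  by apply: card_le_lt_trans Mn; apply: subset_card_le; exact: subIsetl.
have sM : small M by apply: card_le_small (small_elts nu) _; case: Mn.
have [k ck kM] := cardinal_equipotent sM.
have kn : k ∈ nu.
  apply: ord_nsub (cardinal_ord ck) on _ => /subset_card_le nk.
  case: Mn => _; apply; exact: card_le_trans nk (card_eq_leW kM).
have [d dn [bd kd]] := ord_max_in on bn kn.
have [e en [de we]] := ord_max_in on dn wn.
exists e; split=> //.
- exact: card_le_infinite (subset_card_le we) omega_infinite.
- by move=> x /bM /bd /de.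
- apply: card_le_trans (card_eq_leW (card_esym kM)) _.
  by apply: subset_card_le => x /kd /de.
Qed.

Lemma all_in_bigcup (M : nat -> set zset) s :
  (forall n, M n `<=` M n.+1) -> all_in (\bigcup_n M n) s -> exists n, all_in (M n) s.
Proof.
move=> Ms; have Mle m n : (m <= n)%N -> M m `<=` M n.
  elim: n => [|n IH]; first by rewrite leqn0 => /eqP ->.
  by rewrite leq_eqVlt => /orP[/eqP -> //|/IH sub x /sub /Ms].
elim: s => [|x s IH] /=; first by exists 0.
move=> [[m _ Mx] /IH[n Mn]]; exists (maxn m n); split.
  by apply: Mle Mx; exact: leq_maxl.
elim: s {IH} Mn => //= y s IH [My /IH ?]; split=> //.
by apply: Mle My; exact: leq_maxr.
Qed.

(* Closing off under d |-> a bound of the trace and of the size of the hull,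
   omega many times, gives a submodel M whose trace on nu is an ordinal d with
   |M| <= |d|. *)
Lemma elem_trace (D A : set zset) (c : zset) (op : nat -> seq zset -> zset) nu :
  regular_cardinal nu -> omega ∈ nu -> elts nu `<=` D -> A `<=` D -> A c ->
  card_lt A (elts nu) ->
  exists M d, [/\ elem_submodel M D c, closed_ops D op M, A `<=` M, d ∈ nu &
    elts d = M `&` elts nu /\ M #<= elts d].
Proof.
move=> nur wn nD AD Ac An; have on : is_ordinal nu by case: nur => -[[]].
have [sk skP] := skolem_ops D c.
pose good (M : set zset) := [/\ A `<=` M, M `<=` D & card_lt M (elts nu)].
(* From M one passes to an ordinal d bounding its trace and size, and to a hull N of M and d. For M
   violating the invariant [good], the value of [next] is arbitrary. *)
pose nextP (M : set zset) (dN : zset * set zset) := good M ->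
  [/\ dN.1 ∈ nu, infinite_set (elts dN.1), M `&` elts nu `<=` elts dN.1 &
      M #<= elts dN.1] /\
  [/\ good dN.2, M `<=` dN.2, elts dN.1 `<=` dN.2 &
      closed_ops D (interleave sk op) dN.2].
have [next nextE] : {next : set zset -> zset * set zset & forall M, nextP M (next M)}.
  apply: (@choice _ _ nextP) => M.
  have [[AM MD Mn]|nM] := pselect (good M); last by exists (omega, M).
  have [d [dn di Md Mdle]] := card_lt_regular_ord nur wn Mn.
  have dD : elts d `<=` D by move=> x xd; apply: nD; exact: (ord_sub on dn).
  have [|||N [MN ND Nop Nle]] := @hull_exists D (M `|` elts d) c (interleave sk op).
  - by move=> x [/MD|/dD].
  - by left; exact: AM.
  - by apply: card_le_infinite di; apply: subset_card_le; exact: subsetUr.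
  have Nd : N #<= elts d by apply: card_le_trans Nle _; exact: card_setU_le.
  exists (d, N) => _; split=> //; split=> //.
  - split=> //; first by move=> x /AM Mx; apply: MN; left.
    apply: (card_le_lt_trans Nd); case: nur => -[[_ cn] _] _; exact: cn.
  - by move=> x Mx; apply: MN; left.
  - by move=> x dx; apply: MN; right.
pose Ms n := iter n (fun M => (next M).2) A.
have gM n : good (Ms n).
  elim: n => [|n IH]; first by split.
  by have [_ []] := nextE _ IH.
pose ds n := (next (Ms n)).1.
have MS n : Ms n `<=` Ms n.+1 by have [_ []] := nextE _ (gM n).
have dn n : ds n ∈ nu by have [[]] := nextE _ (gM n).
have dM n : elts (ds n) `<=` Ms n.+1 by have [_ []] := nextE _ (gM n).
have Md n : Ms n `&` elts nu `<=` elts (ds n) by have [[]] := nextE _ (gM n).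
have Mle n : Ms n #<= elts (ds n) by have [[]] := nextE _ (gM n).
have Mop n : closed_ops D (interleave sk op) (Ms n.+1).
  by have [_ []] := nextE _ (gM n).
pose M := \bigcup_n Ms n.
(* The stages alternate: the trace of [Ms n] is included in [ds n], and [ds n] in [Ms n.+1]. Hence
   the trace of the union is a union of ordinals. *)
have trE : M `&` elts nu = \bigcup_(n in [set: nat]) elts (ds n).
  apply/seteqP; split=> [x [[n _ Mx] nx]|x [n _ dx]].
    by exists n => //; exact: Md.
  by split; [exists n.+1 => //; exact: dM|exact: (ord_sub on (dn n))].
have [|||d od dE] := @ord_of_set (M `&` elts nu).
- by apply: small_subset (small_elts nu) _; exact: subIsetr.
- by move=> x [_ /(ord_elt on)].
- move=> x y; rewrite trE => -[n _ xd] yx; exists n => //.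
  exact: (ord_sub (ord_elt on (dn n)) xd).
(* Countably many ordinals below the regular nu > omega are bounded, so the trace stays a proper
   initial segment of nu. *)
have [||b bn bd] := nur.2 (range ds).
- by move=> _ [n _ <-].
- apply: card_le_lt_trans (card_image_le _ _) _.
  apply: card_le_lt_trans (card_eq_leW (card_esym card_omega)) _.
  by case: nur => -[[_ cn] _] _; exact: cn.
have ob := ord_elt on bn.
have dinu : d ∈ nu.
  have [|db|->//] := ord_subE od ob.
    rewrite dE trE => x [n _ xd]; apply: (ord_sub ob) xd.
    by apply: bd; exists n.
  exact: (ord_sub on bn).
have di : infinite_set (elts d).
  have [[_ di _ _] _] := nextE _ (gM 0).
  apply: card_le_infinite di; apply: subset_card_le.
  by rewrite dE trE => x dx; exists 0.
have Mc : M c by exists 0.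
have MD : M `<=` D by move=> x [n _ Mx]; have [_ + _] := gM n; apply.
have [Msk Mopc] : closed_ops D sk M /\ closed_ops D op M.
  apply: closed_ops_interleave => k s /(all_in_bigcup MS)[n sM] Dks.
  exists n.+1 => //; apply: Mop => //.
  by elim: s sM {Dks} => //= x s IH [/MS ? /IH].
exists M, d; split=> //; first exact: skP.
  by move=> x Ax; exists 0.
split=> //; apply: card_bigcup_le => //; first exact: card_nat_le.
move=> n _; apply: card_le_trans (Mle n) _; apply: subset_card_le.
by rewrite dE trE => x dx; exists n.
Qed.

Lemma good_trace_large lambda M : is_ordinal lambda -> small M ->
  elts lambda `<=` M -> good_trace lambda M.
Proof.
move=> ol sM lM; split; last first.
  exists lambda; split; first by right.
  by apply/seteqP; split=> [x lx|x []//]; split=> //; exact: lM.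
have [mu cmu muM] := cardinal_equipotent sM.
by exists mu; split=> // x [_ lx]; split=> //; exact: lM.
Qed.

(** Since M embeds in d, the cardinal of M is included in d; and the trace of M on lambda is the
    smaller of d and lambda. *)
Lemma good_trace_ord lambda nu M d : is_ordinal lambda -> is_ordinal nu ->
  elts lambda `<=` elts nu -> is_ordinal d -> elts d = M `&` elts nu ->
  M #<= elts d -> good_trace lambda M.
Proof.
move=> ol on ln od dE Md.
have MlE : M `&` elts lambda = elts d `&` elts lambda.
  rewrite dE; apply/seteqP; split=> x; last by move=> [[]].
  by move=> [Mx /[dup] /ln].
have sM := card_le_small (small_elts d) Md.
have [mu cmu muM] := cardinal_equipotent sM.
split.
  exists mu; split=> //; rewrite MlE; apply: setSI.
  by apply: cardinal_sub => //; exact: card_le_trans (card_eq_leW muM) Md.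
rewrite MlE; have [dl|->|ld] := ord_trichotomy od ol.
- exists d; split; first by left.
  by apply/seteqP; split=> [x dx|x []//]; split=> //; exact: (ord_sub ol dl).
- by exists lambda; split; [right|rewrite setIid].
- exists lambda; split; first by right.
  by apply/seteqP; split=> [x dx|x []//]; split=> //; exact: (ord_sub od ld).
Qed.

(** * Separation by a family of sets in a compactum *)

(** Compactness in place of finite subcovers: a property stable under finite unions that holds
    locally holds of a set whose interior covers K. *)
Lemma compact_ideal (X : topologicalType) (K : set X) (Q : set (set X)) :
  compact K -> Q set0 -> (forall A B, Q A -> Q B -> Q (A `|` B)) ->
  (forall x, K x -> exists2 N, nbhs x N & Q N) ->
  exists2 A, Q A & K `<=` A°.
Proof.
move=> /compact_near_coveringP cK Q0 QU Kx.
(* The filter of families containing all sufficiently large members of Q; the near-covering form of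
   compactness is applied along it. *)
pose F : set_system (set X) :=
  [set S | exists2 A, Q A & forall B, Q B -> A `<=` B -> S B].
have FF : Filter F.
  split=> [|S T [A QA AS] [B QB BT]|S T ST [A QA AS]].
  - by exists set0.
  - exists (A `|` B); first exact: QU.
    move=> C QC ABC; split.
      by apply: AS => // x Ax; apply: ABC; left.
    by apply: BT => // x Bx; apply: ABC; right.
  - by exists A => // B QB AB; apply/ST/AS.
have [|A QA AK] := cK _ F (fun B x => (B : set X)° x) FF.
  move=> x /Kx[N xN QN].
  exists (N°, [set B | N `<=` B]) => /=; last first.
    by move=> [y B] [/= Ny /interiorS]; apply.
  split; first by apply: open_nbhs_nbhs; split; [exact: open_interior|].
  by exists N.
by exists A => //; exact: AK.
Qed.

(** For SS = [coded_in code M] this unfolds to [M_separated code M]. *)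
Definition sep (X : topologicalType) (SS : set (set X)) (p q : X) :=
  exists U V : set X, [/\ [/\ closed U, nbhs p U & SS U],
    [/\ closed V, nbhs q V & SS V] & U `&` V = set0].

(** The closure properties through which elementarity enters the topological arguments;
    [family_normal] is normality with witnesses inside the family. *)
Record model_family (X : topologicalType) (SS : set (set X)) : Prop := {
  family_nonempty : SS !=set0;
  familyC : forall A, SS A -> SS (~` A);
  familyU : forall A B, SS A -> SS B -> SS (A `|` B);
  family_interior : forall A, SS A -> SS A°;
  family_normal : forall A B, closed A -> closed B -> A `&` B = set0 ->
    SS A -> SS B -> exists A' B', [/\ [/\ closed A', A `<=` A'° & SS A'],
      [/\ closed B', B `<=` B'° & SS B'] & A' `&` B' = set0] }.

Section Separation.
Variables (X : topologicalType) (SS : set (set X)).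
Hypothesis SSf : model_family SS.

Lemma familyI A B : SS A -> SS B -> SS (A `&` B).
Proof.
move=> SA SB; rewrite -[A `&` B]setCK setCI.
by apply/(familyC SSf)/(familyU SSf); exact: familyC.
Qed.

Lemma familyT : SS setT.
Proof.
have [A SA] := family_nonempty SSf; rewrite -(setUv A).
by apply: familyU => //; exact: familyC.
Qed.

Lemma family0 : SS set0.
Proof. by rewrite -setCT; apply: familyC => //; exact: familyT. Qed.

Lemma sep_sym p q : sep SS p q -> sep SS q p.
Proof. by move=> [U [V [pU qV UV]]]; exists V, U; split; rewrite // setIC. Qed.

Lemma sep_irr p : ~ sep SS p p.
Proof.
move=> [U [V [[_ /nbhs_singleton pU _] [_ /nbhs_singleton pV _] UV]]].
by have : (U `&` V) p by []; rewrite UV.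
Qed.

(** If U and V separate p from r, normality in SS enlarges them to disjoint U' and V'. The point q
    misses one of these, and the complement of its interior then separates q from p or from r. *)
Lemma nsep_trans p q r : ~ sep SS p q -> ~ sep SS q r -> ~ sep SS p r.
Proof.
move=> npq nqr [U [V [[cU pU SU] [cV rV SV] UV]]].
have [U' [V' [[cU' UU' SU'] [cV' VV' SV'] UV']]] := family_normal SSf cU cV UV SU SV.
have sub (A A' : set X) x : closed A' -> SS A' -> A `<=` A'° -> ~ A' x ->
    [/\ closed (~` A'°), nbhs x (~` A'°) & SS (~` A'°)] /\ A `&` ~` A'° = set0.
  move=> cA' SA' AA' nA'; split; last first.
    by apply/seteqP; split=> // y [/AA' ? ].
  split; last by apply: (familyC SSf); exact: family_interior.
    exact/open_closedC/open_interior.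
  apply: (@filterS _ _ _ (~` A')); first by apply: subsetC; exact: interior_subset.
  by apply: open_nbhs_nbhs; split=> //; exact: closed_openC.
have [V'q|nV'q] := pselect (V' q).
  have [|qC UC] := sub U U' q cU' SU' UU'.
    by move=> U'q; have : (U' `&` V') q by []; rewrite UV'.
  by apply: npq; exists U, (~` U'°).
have [qC VC] := sub V V' q cV' SV' VV' nV'q.
by apply: nqr; exists (~` V'°), V; rewrite setIC.
Qed.

Lemma nsep_closed_open (F G : set X) x u : closed F -> SS F -> open G -> SS G ->
  F `<=` G -> F x -> ~ sep SS x u -> G u.
Proof.
move=> cF SF oG SG FG Fx; apply: contra_notP => nGu.
have [||U [V [[cU FU SU] [cV GV SV] UV]]] := family_normal SSf cF (open_closedC oG) _ SF.
- by apply/seteqP; split=> // y [/FG].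
- exact: familyC.
exists U, V; split=> //; split=> //.
  by apply: filterS (@interior_subset _ U) _; apply: open_nbhs_nbhs;
     split; [exact: open_interior|exact: FU].
by apply: filterS (@interior_subset _ V) _; apply: open_nbhs_nbhs;
     split; [exact: open_interior|exact: GV].
Qed.

(** Two rounds of compactness: first over Z for a fixed point k of K, with the ideal of sets missed
    by a closed neighborhood of k in SS, then over K. *)
Lemma sep_compact (K Z : set X) : compact K -> compact Z ->
  (forall k z, K k -> Z z -> sep SS k z) ->
  exists T, [/\ closed T, SS T, K `<=` T° & T `&` Z = set0].
Proof.
move=> cK cZ KZ.
have [||k Kk|T [cT ST TZ] KT] :=
  @compact_ideal _ K [set T | [/\ closed T, SS T & T `&` Z = set0]] cK.
- by split; [exact: closed0|exact: family0|exact: set0I].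
- move=> A B [cA SA AZ] [cB SB BZ]; split.
  + exact: closedU.
  + exact: familyU.
  + by rewrite setIUl AZ BZ setU0.
- have [||z Zz|V [U [cU kU SU UV]] ZV] := @compact_ideal _ Z
    [set V | exists U, [/\ closed U, nbhs k U, SS U & U `&` V = set0]] cZ.
  + exists setT; split; [exact: closedT|exact: filterT|exact: familyT|exact: setI0].
  + move=> V V' [U [cU kU SU UV]] [U' [cU' kU' SU' UV']]; exists (U `&` U'); split.
    * exact: closedI.
    * exact: filterI.
    * exact: familyI.
    * by rewrite setIUr -setIA (setIC U') [U `&` (V `&` U')]setIA UV set0I -setIA UV' setI0 setU0.
  + have [U [V [[cU kU SU] [cV zV SV] UV]]] := KZ _ _ Kk Zz.
    by exists V => //; exists U.
  + exists U => //; split=> //.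
    apply/seteqP; split=> // y [Uy /ZV/interior_subset Vy].
    by have : (U `&` V) y by []; rewrite UV.
by exists T.
Qed.

(** For a [model_family] this is the saturation of U, the preimage of its image in the quotient by
    non-separation. *)
Definition sat_hull (U : set X) := [set x | exists2 u, U u & ~ sep SS x u].

Lemma sat_hull_sub U : U `<=` sat_hull U.
Proof. by move=> u Uu; exists u => //; exact: sep_irr. Qed.

Lemma sat_hull_nsep U x y : ~ sep SS x y -> sat_hull U x -> sat_hull U y.
Proof.
move=> nxy [u Uu nxu]; exists u => //; apply: nsep_trans nxu.
by move=> /sep_sym.
Qed.

(** As O is saturated, x is separated from every point outside O, and [sep_compact] makes this
    uniform. *)
Lemma sat_nbhs (O : set X) x : compact [set: X] -> open O -> O x ->
  (forall y z, ~ sep SS y z -> O y -> O z) ->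
  exists T, [/\ closed T, SS T, T° x & T `<=` O].
Proof.
move=> cX oO Ox Os.
have [||k z -> nOz|T [cT ST xT TO]] := @sep_compact [set x] (~` O).
- exact: compact_set1.
- by apply: (subclosed_compact _ cX) => //; exact: open_closedC.
- by apply: contrapT => /Os/(_ Ox).
exists T; split=> //; first exact: xT.
move=> y Ty; apply: contrapT => nOy; have : (T `&` ~` O) y by [].
by rewrite TO.
Qed.

End Separation.

(** * Continuous images of openly generated compacta *)

Lemma compactum_closed_nbhs (X : topologicalType) (x : X) (N : set X) :
  compactum X -> nbhs x N -> exists C, [/\ closed C, nbhs x C & C `<=` N].
Proof.
move=> [cX hX] xN.
have [B xB BN] := @compact_regular X x setT hX cX (@filterT _ _ _) _ xN.
exists (closure B); split=> //; first exact: closed_closure.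
by apply: filterS xB; exact: subset_closure.
Qed.

Lemma compactum_separate (X : topologicalType) (x y : X) : compactum X ->
  x <> y -> exists C D, [/\ closed C, nbhs x C, closed D, nbhs y D & C `&` D = set0].
Proof.
move=> /[dup] XC [cX]; rewrite open_hausdorff => hX /eqP/hX[[A B] /=].
rewrite !inE => -[Ax By] [oA oB AB].
have [|C [cC xC CA]] := compactum_closed_nbhs (x := x) (N := A) XC.
  exact: open_nbhs_nbhs.
have [|D [cD yD DB]] := compactum_closed_nbhs (x := y) (N := B) XC.
  exact: open_nbhs_nbhs.
exists C, D; split=> //; apply/seteqP; split=> // z [/CA Az /DB Bz].
by have : (A `&` B) z by []; rewrite AB.
Qed.

Lemma closed_setD (X : topologicalType) (A B : set X) :
  closed A -> open B -> closed (A `\` B).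
Proof. by move=> cA oB; rewrite setDE; apply: closedI => //; exact: open_closedC. Qed.

Lemma closed_compactum (X : topologicalType) (A : set X) :
  compactum X -> closed A -> compact A.
Proof. by move=> [cX _] cA; apply: (subclosed_compact cA cX). Qed.

Lemma closed_image (X Y : topologicalType) (f : X -> Y) (A : set X) :
  compactum X -> compactum Y -> continuous f -> closed A -> closed (f @` A).
Proof.
move=> cX [_ hY] cf cA; apply: compact_closed => //.
apply: continuous_compact; last exact: closed_compactum.
exact: continuous_subspaceT.
Qed.

Lemma closed_fiber (X Y : topologicalType) (f : X -> Y) (y : Y) :
  compactum Y -> continuous f -> closed (f @^-1` [set y]).
Proof.
move=> [_ hY] cf; have cl : closed [set y].
  by apply: compact_closed => //; exact: compact_set1.
by move/continuous_closedP : cf => /(_ _ cl).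
Qed.

(** Zorn's lemma for the open sets whose complement still maps onto Y. If the union of a chain lost
    a point y, the fiber of y would be compact and covered by the chain, hence by one member of
    it. *)
Lemma irreducible_restriction (X Y : topologicalType) (f : X -> Y) :
  compactum X -> compactum Y -> continuous f -> range f = setT ->
  exists X' : set X, [/\ closed X', f @` X' = setT &
    forall E, closed E -> E `<=` X' -> f @` E = setT -> X' `<=` E].
Proof.
move=> XC YC cf fs.
have [F FP Ft|U [[oU Us] Umax]] :=
    @Zorn_bigcup _ (fun U : set X => open U /\ f @` (~` U) = setT).
  split; first by apply: bigcup_open => U /FP[].
  apply/seteqP; split=> // y _; apply: contrapT => ny.
  have fy : f @^-1` [set y] `<=` \bigcup_(U in F) U.
    by move=> x /= fx; apply: contrapT => nx; apply: ny; exists x.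
  have [||||A QA yA] := @compact_ideal X (f @^-1` [set y])
      (fun A => A = set0 \/ exists2 U, F U & A `<=` U).
  - exact/(closed_compactum XC)/closed_fiber.
  - by left.
  - move=> A B [->|[U FU AU]]; first by rewrite set0U.
    move=> [->|[V FV BV]]; first by right; exists U => //; rewrite setU0.
    by right; have [UV|VU] := Ft _ _ FU FV; [exists V|exists U] => //;
      rewrite subUset; split=> // x; [move=> /AU/UV|move=> /BV/VU].
  - move=> x /fy[U FU Ux]; exists U; last by right; exists U.
    by apply: open_nbhs_nbhs; split=> //; have [] := FP _ FU.
  have [x _ fx] : range f y by rewrite fs.
  case: QA yA => [-> /(_ x fx)/interior_subset//|[U FU AU] yA].
  have [_ Us] := FP _ FU; have [z nUz fz] : (f @` (~` U)) y by rewrite Us.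
  by apply: nUz; apply: AU; apply: interior_subset; exact: yA.
exists (~` U); split=> // [|E cE EU Es]; first exact: open_closedC.
apply: contrapT => nUE; apply: (Umax (~` E)); last first.
  by split; [exact: closed_openC|rewrite setCK].
split; first exact: subsetCr.
by move=> /subsetCl.
Qed.

Lemma basis_nbhs (X : topologicalType) (B : set (set X)) x N :
  basis B -> nbhs x N -> exists U, [/\ B U, U x, open U & U `<=` N].
Proof.
move=> [Bo Bb] /Bb[U [BU Ux] UN]; exists U; split=> //; exact: Bo.
Qed.

(* The members of [SS] are thought of as the subsets of X lying in an elementary
   submodel. If two points of X' not separated by SS had different images, then
   by irreducibility of X' the two members U, U' of B chosen around them would
   trap a set G of the submodel such that every fiber of G in X' meets, up to
   separation, both U and U'; this is refuted at a point of G with a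
   local pi-base in the submodel. *)
Lemma family_image_base (X Y : topologicalType) (f : X -> Y) (X' : set X)
    (SS B : set (set X)) :
  compactum X -> compactum Y -> continuous f -> closed X' -> f @` X' = setT ->
  (forall E, closed E -> E `<=` X' -> f @` E = setT -> X' `<=` E) ->
  model_family SS ->
  (forall E, SS E -> SS (f @^-1` (~` (f @` (X' `\` E))))) ->
  (forall G, open G -> G !=set0 -> SS (f @^-1` G) ->
    exists2 p, G p & exists2 P, local_pi_base p P & forall W, P W -> SS (f @^-1` W)) ->
  (forall W, open W -> W !=set0 -> SS (f @^-1` W) ->
    exists F, [/\ closed F, SS F, F `<=` f @^-1` W & F `&` X' !=set0]) ->
  basis B -> (forall U, B U -> open (sat_hull SS U)) ->
  forall q N, nbhs q N -> exists G, [/\ open G, G q, G `<=` N & SS (f @^-1` G)].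
Proof.
move=> XC YC cf cX' fX' irr SSf SSr SSp SSF Bb Bo.
have fo W : open W -> open (f @^-1` W) by move/continuousP : cf => /(_ W).
have fnbhs x N : nbhs (f x) N -> nbhs x (f @^-1` N) by exact: cf.
have openr E : SS E -> open E -> open (~` (f @` (X' `\` E))).
  by move=> SE oE; apply/closed_openC/closed_image => //; exact: closed_setD.
have key u u' : X' u -> X' u' -> ~ sep SS u u' -> f u = f u'.
  move=> X'u X'u' nuu'; apply: contrapT => nfu.
  have [C [C' [cC uC cC' u'C' CC']]] := compactum_separate YC nfu.
  have [U [BU Uu oU UC]] := basis_nbhs Bb (fnbhs _ _ uC).
  have [U' [BU' U'u' oU' UC']] := basis_nbhs Bb (fnbhs _ _ u'C').
  pose O := sat_hull SS U `&` sat_hull SS U'.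
  have [||||T [cT ST uT TO]] := @sat_nbhs X SS SSf O u.
  - by case: XC.
  - by apply: openI; exact: Bo.
  - split; first exact: sat_hull_sub.
    by exists u'.
  - by move=> y z nyz [yU yU']; split; exact: (sat_hull_nsep SSf nyz).
  pose E := T°; have oE : open E by exact: open_interior.
  have SE : SS E by exact: family_interior.
  (* The points of Y whose fibers in X' lie in E. If there were none, [X']\[E] would map onto Y, and
     irreducibility would expel u from E. *)
  pose G := ~` (f @` (X' `\` E)).
  have oG : open G by exact: openr.
  have G0 : G !=set0.
    apply: contrapT => nG; have [|||_ /(_ uT)] := irr (X' `\` E) _ _ _ u X'u => //.
    - exact: closed_setD.
    - apply/seteqP; split=> // y _; apply: contrapT => ny.
      by apply: nG; exists y.
  (* A member W of the local pi-base fits into G minus D. A point x of X' over W lies in E, so it is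
     not separated from some v in V; then v lies over W as well as over D, a contradiction. *)
  have main p P (V : set X) (D : set Y) : G p -> local_pi_base p P ->
      (forall W, P W -> SS (f @^-1` W)) -> closed D -> ~ D p ->
      V `<=` f @^-1` D -> (forall x, O x -> sat_hull SS V x) -> False.
    move=> Gp [Po Pb] SP cD nDp VD OV.
    have [|W PW WGD] := Pb (G `&` ~` D).
      by apply: open_nbhs_nbhs; split=> //; apply: openI => //; exact: closed_openC.
    have [oW W0] := Po _ PW.
    have [F [cF SF FW [x [Fx X'x]]]] := SSF _ oW W0 (SP _ PW).
    have [Gfx _] := WGD _ (FW _ Fx).
    have Ex : E x by apply: contrapT => nEx; apply: Gfx; exists x.
    have [v Vv nxv] := OV _ (TO _ (interior_subset Ex)).
    have Wv := nsep_closed_open SSf cF SF (fo _ oW) (SP _ PW) FW Fx nxv.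
    by have [_] := WGD _ Wv; apply; exact: VD.
  have [p Gp [P Pp SP]] := SSp _ oG G0 (SSr _ SE).
  (* C and C' are disjoint, so p misses one of them and [main] applies to that one. *)
  have [Cp|nCp] := pselect (C p).
    apply: (main p P U' C') => //; last by move=> x [].
    by move=> C'p; have : (C `&` C') p by []; rewrite CC'.
  by apply: (main p P U C) => //; move=> x [].
move=> q N /nbhs_interior qN.
have oN : open N° by exact: open_interior.
(* By [key], points of X' over q are separated from points of X' not over the interior of N. The set
   of points whose fibers in X' lie in the interior of T is the required G. *)
have [|||T [cT ST KT TZ]] := @sep_compact X SS SSf (X' `&` f @^-1` [set q])
    (X' `&` ~` (f @^-1` N°)).
- apply: closed_compactum => //; apply: closedI => //; exact: closed_fiber.
- apply: closed_compactum => //; apply: closedI => //; exact/open_closedC/fo.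
- move=> k z [X'k kq] [X'z nz]; apply: contrapT => /(key _ _ X'k X'z) E.
  by apply: nz; rewrite /= -E kq; exact: nbhs_singleton.
exists (~` (f @` (X' `\` T°))); split.
- by apply: openr; [exact: family_interior|exact: open_interior].
- by move=> [x [X'x nTx] fx]; apply/nTx/KT.
- move=> y ny; have [x X'x fx] : (f @` X') y by rewrite fX'.
  have Tx : T° x by apply: contrapT => nTx; apply: ny; exists x.
  rewrite -fx; apply: interior_subset; apply: contrapT => nNx.
  have : (T `&` (X' `&` ~` (f @^-1` N°))) x by split; [exact: interior_subset|].
  by rewrite TZ.
- by apply: SSr; exact: family_interior.
Qed.

(** V is the interior of a member of SS inside the open saturation of U. A point in a closed F of SS
    below W is not separated from some u in U, and [nsep_closed_open] puts u into W. *)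
Lemma family_dense_below (X : topologicalType) (SS : set (set X)) (U : set X) :
  compact [set: X] -> model_family SS ->
  (forall G, open G -> G !=set0 -> SS G ->
    exists F, [/\ closed F, SS F, F `<=` G & F !=set0]) ->
  U !=set0 -> open (sat_hull SS U) ->
  exists V, [/\ open V, V !=set0, SS V & forall W, open W -> W !=set0 -> SS W ->
    W `<=` V -> W `&` U !=set0].
Proof.
move=> cX SSf SSF [x Ux] oU.
have [|y z nyz|T [cT ST xT TU]] := @sat_nbhs X SS SSf (sat_hull SS U) x cX oU.
- exact: sat_hull_sub.
- exact: sat_hull_nsep.
exists T°; split; [exact: open_interior|by exists x|exact: family_interior|].
move=> W oW W0 SW WT; have [F [cF SF FW [y Fy]]] := SSF _ oW W0 SW.
have [u Uu nyu] := TU _ (interior_subset (WT _ (FW _ Fy))).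
by exists u; split=> //; exact: (nsep_closed_open SSf cF SF oW SW FW Fy nyu).
Qed.

Definition coded_in (X : topologicalType) (code : X -> zset) (M : set zset) :=
  [set S : set X | exists2 u, M u & codes_set code S u].

(** For kappa = omega the image of U in the quotient is a finite intersection of open sets, hence
    open; the saturation is its preimage. *)
Lemma M_base_sat_open (R : realType) (X : topologicalType) (code : X -> zset)
    (M : set zset) (B : set (set X)) (U : set X) :
  model_family (coded_in code M) -> M_base R omega code M B -> B U ->
  open (sat_hull (coded_in code M) U).
Proof.
move=> Mf [_ MB] /MB[_ [W [/card_lt_omega fW Wo UE]]].
have piE := @piME X code M (fun p q r => @nsep_trans X _ Mf p q r).
have -> : sat_hull (coded_in code M) U = piM code M @^-1` (piM code M @` U).
  apply/seteqP; split=> [x [u Uu nxu]|x /= [u Uu ux]].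
    exists u => //; apply: contrapT => /piE.
    by move=> /(sep_sym (SS := coded_in code M)).
  by exists u => //; move=> /piE; rewrite ux.
have cpi : continuous (piM code M).
  exact: (@pi_continuous _ _ : continuous (\pi_(M_quotient code M) : X -> M_quotient code M)).
move/continuousP : cpi; apply.
have [D WD] := finite_fsetP.1 fW.
rewrite UE WD openE => x Dx; rewrite /interior.
apply: filter_bigI => w wD; apply: open_nbhs_nbhs; split; last exact: Dx.
by apply: Wo; rewrite WD.
Qed.

(** * Submodels containing codes of subsets of a compactum *)

Lemma codes_set_inj (X : Type) (code : X -> zset) (S : set X) u v :
  codes_set code S u -> codes_set code S v -> u = v.
Proof. by move=> Su Sv; apply: elts_inj; rewrite Su Sv. Qed.

Lemma encoding_exists (X : Type) (code : X -> zset) : is_coding code ->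
  exists (enc : set X -> zset) (dec : zset -> set X),
    (forall S, codes_set code S (enc S)) /\ cancel enc dec.
Proof.
move=> [ci [x0 x0E]].
have [enc encE] : {enc : set X -> zset & forall S, codes_set code S (enc S)}.
  apply: (@choice _ _ (fun S u => codes_set code S u)) => S.
  apply: (small_subset (small_elts x0)); rewrite x0E.
  by move=> _ [x _ <-]; exists x.
exists enc, (fun u => [set x | code x ∈ u]); split=> // S.
have eS : elts (enc S) = code @` S by exact: encE.
by apply/seteqP; split=> x /=; rewrite eS; [case=> y Sy /ci <-|move=> Sx; exists x].
Qed.

Lemma coded_inE (T : topologicalType) (code : T -> zset)
    (enc : set T -> zset) (M : set zset) (S : set T) :
  (forall S, codes_set code S (enc S)) -> coded_in code M S <-> M (enc S).
Proof.
move=> encE; split=> [[u Mu Su]|]; last by exists (enc S).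
by rewrite (codes_set_inj (encE S) Su).
Qed.

Lemma compactum_normal (X : topologicalType) (A B : set X) : compactum X ->
  closed A -> closed B -> A `&` B = set0 ->
  exists A' B', [/\ closed A', A `<=` A'°, closed B', B `<=` B'° &
    A' `&` B' = set0].
Proof.
move=> [cX hX]; have nX := compact_normal hX cX.
have step (C D : set X) : closed C -> closed D -> C `&` D = set0 ->
    exists C', [/\ closed C', C `<=` C'° & C' `&` D = set0].
  move=> cC cD CD; have [|E CE ED] := nX C cC (~` D).
    apply/set_nbhsP; exists (~` D); split=> //; first exact: closed_openC.
    exact/disjoints_subset.
  exists (closure E); split; first exact: closed_closure.
    move=> x Cx; apply: (@filterS _ _ _ E); first exact: subset_closure.
    exact: CE.
  by apply/disjoints_subset.
move=> cA cB AB; have [A' [cA' AA' A'B]] := step _ _ cA cB AB.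
have [|B' [cB' BB' B'A']] := step _ _ cB cA'; first by rewrite setIC.
by exists A', B'; split=> //; rewrite setIC.
Qed.

(** Arguments and values are codes of subsets of X, with [omega] in place of missing arguments;
    [nrm] chooses witnesses for normality. *)
Definition set_ops (X : topologicalType) (enc : set X -> zset)
    (dec : zset -> set X) (nrm : set X * set X -> set X * set X)
    (extra : nat -> seq zset -> zset) (k : nat) (s : seq zset) : zset :=
  let A := dec (nth omega s 0) in let B := dec (nth omega s 1) in
  match k with
  | 0 => enc (~` A)
  | 1 => enc (A `|` B)
  | 2 => enc A°
  | 3 => enc (nrm (A, B)).1
  | 4 => enc (nrm (A, B)).2
  | k'.+4.+1 => extra k' s
  end.

Lemma coded_family (X : topologicalType) (code : X -> zset)
    (enc : set X -> zset) (dec : zset -> set X) (D : set zset)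
    (extra : nat -> seq zset -> zset) :
  compactum X -> (forall S, codes_set code S (enc S)) -> cancel enc dec ->
  (forall S, D (enc S)) ->
  exists op, forall M, M !=set0 -> closed_ops D op M ->
    model_family (coded_in code M) /\ closed_ops D extra M.
Proof.
move=> XC encE encK Denc.
pose nP (P Q : set X * set X) := closed P.1 -> closed P.2 -> P.1 `&` P.2 = set0 ->
  [/\ closed Q.1, P.1 `<=` Q.1°, closed Q.2, P.2 `<=` Q.2° & Q.1 `&` Q.2 = set0].
have [nrm nrmE] : {nrm : set X * set X -> set X * set X & forall P, nP P (nrm P)}.
  apply: (@choice _ _ nP) => -[A B].
  have [[cA cB AB]|nAB] := pselect [/\ closed A, closed B & A `&` B = set0].
    by have [A' [B' ?]] := compactum_normal XC cA cB AB; exists (A', B').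
  by exists (A, B) => cA cB AB; case: nAB.
exists (set_ops enc dec nrm extra) => M [m Mm] Mop.
have cE S : coded_in code M S <-> M (enc S) by exact: coded_inE.
split; last by move=> k s sM Dk; exact: (Mop k.+4.+1 s).
have op1 k A B : M (enc A) -> M (enc B) ->
    D (set_ops enc dec nrm extra k [:: enc A; enc B]) ->
    M (set_ops enc dec nrm extra k [:: enc A; enc B]).
  by move=> MA MB; apply: Mop.
have famC S : coded_in code M S -> coded_in code M (~` S).
  by move=> /cE MS; apply/cE; have := op1 0 S S MS MS; rewrite /= !encK; apply.
split=> //.
- exists (~` (dec m)); apply/cE.
  by have := Mop 0 [:: m] (conj Mm I); rewrite /=; apply.
- move=> A B /cE MA /cE MB; apply/cE.
  by have := op1 1 A B MA MB; rewrite /= !encK; apply.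
- move=> S /cE MS; apply/cE; have := op1 2 S S MS MS; rewrite /= !encK; apply.
  exact: Denc.
- move=> A B cA cB AB /cE MA /cE MB.
  have [cA' AA' cB' BB' AB'] := nrmE (A, B) cA cB AB.
  exists (nrm (A, B)).1, (nrm (A, B)).2; split=> //; split=> //; apply/cE.
    by have := op1 3 A B MA MB; rewrite /= !encK; apply.
  by have := op1 4 A B MA MB; rewrite /= !encK; apply.
Qed.

(** D is H(theta) for a theta large enough to contain all codes of subsets of X; [z0] brings in the
    ordinals that the submodels have to trace. *)
Lemma lk_base_submodels (R : realType) (lambda z0 : zset) (X : topologicalType)
    (code : X -> zset) (B : set (set X)) :
  is_coding code -> lk_base R lambda omega code B ->
  exists (D : set zset) (b : zset),
    [/\ forall S u, codes_set code S u -> D u,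
        forall y, y ∈ z0 -> D y, D b &
        forall M, elem_submodel M D b -> good_trace lambda M ->
          M_base R omega code M B].
Proof.
move=> [ci [x0 x0E]] [_ [b bB [t0 ct0 H]]].
have [z zE] := small_setU (small_setU (small_set1 x0) (small_set1 z0)) (small_set1 b).
have [t [tr t0t tH]] := large_regular z ct0.
exists (Hset t), b; split=> [S u Su|y yz0||M]; last exact: H.
- apply: tH => y; rewrite (Su : elts u = _) => -[x _ <-].
  apply/tcP; right; exists x0; first by rewrite zE; left; left.
  by apply/tcP; left; rewrite x0E; exists x.
- apply: tH => x xy; apply/tcP; right; exists z0; first by rewrite zE; left; right.
  by apply/tcP; right; exists y => //; apply/tcP; left.
- apply: tH => x xb; apply/tcP; right; exists b; first by rewrite zE; right.
  by apply/tcP; left.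
Qed.

(** * Calibers *)

Fixpoint meet_seq (X : Type) (F : zset -> set X) (s : seq zset) : set X :=
  if s is i :: s' then F i `&` meet_seq F s' else setT.

(** The finite intersection property of V together with the [F i], i in I; lists stand for finite
    subsets of I. *)
Definition meet_finite (X : Type) (F : zset -> set X) (V : set X)
    (I : set zset) :=
  forall s, all_in I s -> V `&` meet_seq F s !=set0.

Lemma all_in_chain (F : set (set zset)) s : total_on F subset -> F !=set0 ->
  all_in (\bigcup_(I in F) I) s -> exists2 I, F I & all_in I s.
Proof.
move=> Ft [I0 FI0]; elim: s => [|i s IH] /=; first by exists I0.
move=> [[I FI Ii] /IH[J FJ Js]].
have [IJ|JI] := Ft _ _ FI FJ; first by exists J => //; split=> //; exact: IJ.
exists I => //; split=> //; elim: s Js {IH} => //= j s IH [/JI ? /IH].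
by [].
Qed.

Lemma maximal_meet_finite (X : Type) (F : zset -> set X) (V : set X)
    (N : set zset) : V !=set0 ->
  exists I, [/\ I `<=` N, meet_finite F V I &
    forall J, J `<=` N -> meet_finite F V J -> I `<=` J -> J `<=` I].
Proof.
move=> V0; have [E EP Et|I [[IN If] Imax]] :=
    @Zorn_bigcup _ (fun I => I `<=` N /\ meet_finite F V I).
  (* For the empty chain only the empty list is tested, and V is nonempty. *)
  have [->|/set0P E0] := eqVneq E set0.
    by rewrite bigcup_set0; split=> // -[_|i s []//]; rewrite setIT.
  split=> [i [I EI Ii]|s /(all_in_chain Et E0)[I EI Is]].
    by have [+ _] := EP _ EI; apply.
  by have [_] := EP _ EI; apply.
exists I; split=> // J JN Jf IJ; apply: contrapT => nJI.
by apply: (Imax J).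
Qed.

(** Otherwise the sets missing some finite intersection of the [F i] would form an ideal containing
    a neighborhood of every point, and X itself would miss one. *)
Lemma meet_finite_closure (X : topologicalType) (F : zset -> set X) (V : set X)
    (I : set zset) : compact [set: X] -> meet_finite F V I ->
  exists x, forall i, I i -> closure (F i) x.
Proof.
move=> cX If; apply: contrapT => nx.
have meet_seq_cat s t : meet_seq F (s ++ t) = meet_seq F s `&` meet_seq F t.
  by elim: s => [|i s IH] /=; rewrite ?setTI // IH setIA.
have all_cat s t : all_in I s -> all_in I t -> all_in I (s ++ t).
  by elim: s => //= i s IH [Ii /IH H] /H.
have [||x _|A [s Is As] XA] := @compact_ideal X setT
    (fun A => exists2 s, all_in I s & A `&` meet_seq F s = set0) cX.
- by exists [::] => //; rewrite set0I.
- move=> A B [s Is As] [t It Bt]; exists (s ++ t); first exact: all_cat.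
  by rewrite meet_seq_cat setIUl setIA As set0I set0U setIA setIAC Bt set0I.
- have [i Ii nix] : exists2 i, I i & ~ closure (F i) x.
    apply: contrapT => ni; apply: nx; exists x => i Ii; apply: contrapT => nix.
    by apply: ni; exists i.
  exists (~` closure (F i)).
    by apply: open_nbhs_nbhs; split=> //; exact/closed_openC/closed_closure.
  exists [:: i] => //=; rewrite setIT; apply/seteqP; split=> // y [ny Fy].
  by apply: ny; exact: subset_closure.
have [x [_ Fx]] := If _ Is.
have : (A `&` meet_seq F s) x by split=> //; apply: interior_subset; exact: XA.
by rewrite As.
Qed.

(** By recursion [phi i] is an element of I above all earlier values, which are bounded because nu
    is regular. *)
Lemma unbounded_enum nu (I : set zset) : regular_cardinal nu ->
  I `<=` elts nu -> (forall b, b ∈ nu -> exists2 i, I i & ~ i ∈ b) ->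
  exists phi : zset -> zset, (forall i, i ∈ nu -> I (phi i)) /\
    (forall i j, i ∈ nu -> j ∈ nu -> i ∈ j -> phi i ∈ phi j).
Proof.
move=> [[[on cn] inu] nur] In Iu.
pose good i (phi : zset -> zset) j := I j /\ forall k, k ∈ i -> phi k ∈ j.
pose step i phi :=
  if pselect (exists j, good i phi j) is left h then projT1 (cid h) else omega.
have [|phi phiE] := @mem_rec _ omega step.
  move=> i f g fg; rewrite /step.
  suff -> : good i f = good i g by [].
  by apply/funext => j; apply/propext; split=> -[Ij H]; split=> // k ki;
    [rewrite -fg|rewrite fg] => //; exact: H.
have phiP i : i ∈ nu -> good i phi (phi i).
  elim/zset_ind: i => i IH inn.
  have ex : exists j, good i phi j.
    have [||b bn bphi] := nur (phi @` elts i).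
    - move=> _ [k ki <-]; apply: In.
      by have [] := IH k ki (ord_sub on inn ki).
    - exact: card_le_lt_trans (card_image_le _ _) (cn _ inn).
    have [j Ij njb] := Iu _ bn; exists j; split=> // k ki.
    have oj := ord_elt on (In _ Ij); have ob := ord_elt on bn.
    have kb : phi k ∈ b by apply: bphi; exists k.
    by have [//|->//|bj] := ord_trichotomy oj ob; exact: (ord_sub oj bj).
  rewrite [in X in good _ _ X]phiE /step; case: pselect => // h.
  exact: (projT2 (cid h)).
exists phi; split=> [i /phiP[]//|i j _ jn ij].
by have [_] := phiP j jn; apply.
Qed.

Lemma closed_set1_compactum (X : topologicalType) (x : X) :
  compactum X -> closed [set x].
Proof. by move=> [_ hX]; apply: compact_closed => //; exact: compact_set1. Qed.

Lemma openly_generated_meet_finite (R : realType) (lambda nu : zset)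
    (X : topologicalType) (code : X -> zset) (B : set (set X))
    (F : zset -> set X) :
  regular_cardinal lambda -> regular_cardinal nu -> omega ∈ nu ->
  elts lambda `<=` elts nu -> compactum X -> is_coding code ->
  lk_base R lambda omega code B -> (forall i, i ∈ nu -> B (F i)) ->
  exists V I, [/\ I `<=` elts nu, meet_finite F V I &
    forall b, b ∈ nu -> exists2 i, I i & ~ i ∈ b].
Proof.
move=> lr nur wn ln XC co lk BF.
have on : is_ordinal nu by case: nur => -[[]].
have [[[_ cn] inu] _] := nur.
have ol : is_ordinal lambda by case: lr => -[[]].
have [[[Bo _] B0] _] := lk.
have Fo i : i ∈ nu -> open (F i) by move=> /BF /Bo.
have [enc [dec [encE encK]]] := encoding_exists co.
have [D [b [Dcode Dnu Db base]]] := @lk_base_submodels R lambda nu X code B co lk.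
have Denc S : D (enc S) by exact: Dcode (encE S).
have [pt ptE] : {pt : set X -> set X & forall S, S !=set0 ->
    exists2 x, S x & pt S = [set x]}.
  apply: (@choice _ _ (fun S P => S !=set0 -> exists2 x, S x & P = [set x])) => S.
  by have [[x Sx]|nS] := pselect (S !=set0); [exists [set x] => _; exists x|exists S].
(* [beta S] bounds a maximal I for S if a bounded one was found. As an operation of the hull, it
   puts this bound into M for every S in the family. *)
have [beta [betan betaE]] : exists beta : set X -> zset, (forall S, beta S ∈ nu) /\
    (forall S, S !=set0 -> (exists2 I, I `<=` elts nu /\ meet_finite F S I &
         forall b, b ∈ nu -> exists2 i, I i & ~ i ∈ b) \/
      exists I, [/\ I `<=` elts (beta S), I `<=` elts nu, meet_finite F S I &
       forall J, J `<=` elts nu -> meet_finite F S J -> I `<=` J -> J `<=` I]).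
  pose Q (S : set X) c := c ∈ nu /\ (S !=set0 ->
    (exists2 I, I `<=` elts nu /\ meet_finite F S I &
         forall b, b ∈ nu -> exists2 i, I i & ~ i ∈ b) \/
      exists I, [/\ I `<=` elts c, I `<=` elts nu, meet_finite F S I &
       forall J, J `<=` elts nu -> meet_finite F S J -> I `<=` J -> J `<=` I]).
  have [beta betaE] : {beta : set X -> zset & forall S, Q S (beta S)}.
    apply: (@choice _ _ Q) => S; rewrite /Q.
    have [S0|nS] := pselect (S !=set0); last by exists omega.
    have [I [In If Imax]] := maximal_meet_finite F (elts nu) S0.
    have [[c cn' cb]|nub] := pselect (exists2 c, c ∈ nu & I `<=` elts c).
      by exists c; split=> // _; right; exists I.
    exists omega; split=> // _; left; exists I => // c cn'.
    apply: contrapT => nc; apply: nub; exists c => // i Ii.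
    by apply: contrapT => nic; apply: nc; exists i.
  by exists beta; split=> S; have [] := betaE S.
pose extra k (s : seq zset) := let x := nth omega s 0 in
  match k with 0 => enc (pt (dec x)) | 1 => enc (F x) | _ => beta (dec x) end.
have [op opP] := @coded_family X code enc dec D extra XC encE encK Denc.
have [||M [d [Mel Mop Mb dn [dE Md]]]] :=
  @elem_trace D [set b] b op nu nur wn Dnu _ erefl.
- by move=> _ ->.
- apply: card_le_lt_trans (cn _ wn).
  apply: card_le_trans (card_eq_leW (card_esym card_omega)).
  by apply: (card_le_map (f := fun=> 0)) => // x y -> ->.
- have {}Mb : M b by apply: Mb.
have od := ord_elt on dn.
have [|Mf Mex] := opP M _ Mop; first by exists b.
set SS := coded_in code M in Mf.
have cE S : SS S <-> M (enc S) by exact: coded_inE.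
have MB := base M Mel (good_trace_ord ol on ln od dE Md).
have Dn i : i ∈ d -> M i by move=> id; have : elts d i by []; rewrite dE => -[].
have SSF i : i ∈ d -> SS (F i).
  move=> id; apply/cE; have := Mex 1 [:: i]; rewrite /extra /=; apply=> //.
  by split=> //; exact: Dn.
have [||V [oV V0 SV Vd]] := @family_dense_below X SS (F d) XC.1 Mf _ (B0 _ (BF _ dn)).
- move=> G oG G0 /cE SG; have [x Gx ptG] := ptE _ G0.
  exists [set x]; split=> [|||]; last by exists x.
  + exact: closed_set1_compactum.
  + by apply/cE; have := Mex 0 [:: enc G]; rewrite /extra /= encK ptG; apply.
  + by move=> _ ->.
- exact: M_base_sat_open Mf MB (BF _ dn).
have [[I [In If] Iu]|[I [Ib In If Imax]]] := betaE _ V0; first by exists V, I.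
(* V is in the family, so [beta V] lies in M and in nu, that is, in d. Thus all of I lies below
   d. *)
have bd : beta V ∈ d.
  rewrite [X in X _]dE; split=> //.
  have /cE MV := SV; have := Mex 2 [:: enc V]; rewrite /extra /= encK; apply=> //.
  exact: Dnu.
have Id : I `<=` elts d by move=> i /Ib; exact: (ord_sub od bd).
have meetsI s : all_in I s -> open (meet_seq F s) /\ SS (meet_seq F s).
  elim: s => [|i s IH] /=; first by split; [exact: openT|exact: familyT].
  move=> [Ii /IH[os Ss]]; split; first by apply: openI => //; exact/Fo/In.
  by apply: familyI => //; exact/SSF/Id.
(* Finite intersections of the [F i], i in I, with V are nonempty open subsets of V in the family,
   so they meet [F d]. *)
have /(Imax (I `|` [set d])) dI : meet_finite F V (I `|` [set d]).
  move=> s sId.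
  have [t [tI ts]] : exists t, all_in I t /\ meet_seq F t `&` F d `<=` meet_seq F s.
    elim: s sId => [|i s IH] /=; first by exists [::].
    move=> [iId /IH[t [tI ts]]]; case: iId => [Ii|->].
      by exists (i :: t); split=> // x [[Fi Ft] Fd]; split=> //; apply: ts.
    by exists t; split=> // x [Ft Fd]; split=> //; apply: ts.
  have [ot St] := meetsI _ tI.
  have [||||x [[Vx tx] dx]] := Vd (V `&` meet_seq F t).
  - exact: openI.
  - exact: If.
  - exact: familyI.
  - exact: subIsetl.
  by exists x; split=> //; apply: ts.
have Iid : I d.
  apply: dI; [|exact: subsetUl|by right].
  by move=> i [/In//|->].
by case: (@mem_irr d); exact: Id.
Qed.

Lemma adic_caliber (R : realType) (lambda nu : zset) (Y : topologicalType) :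
  regular_cardinal lambda -> adic R lambda omega Y ->
  regular_cardinal nu -> omega ∈ nu -> elts lambda `<=` elts nu ->
  is_caliber Y nu.
Proof.
move=> lr [X [XC [code co [B lk]] [f cf fs]]] nur wn ln; split=> // U Uo.
have [[Bb B0] _] := lk.
(* The closure of [F i] is kept inside the preimage of [U i], since compactness yields a common
   point of the closures only. *)
have [F FE] : {F : zset -> set X & forall i, i ∈ nu ->
    B (F i) /\ closure (F i) `<=` f @^-1` (U i)}.
  apply: (@choice _ _ (fun i S => i ∈ nu -> B S /\ closure S `<=` f @^-1` (U i))) => i.
  have [inu|] := pselect (i ∈ nu); last by exists setT.
  have [oU [y Uy]] := Uo _ inu; have [x _ fx] : range f y by rewrite fs.
  have [|C [cC xC CU]] := @compactum_closed_nbhs X x (f @^-1` (U i)) XC.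
    by apply: cf; rewrite fx; exact: open_nbhs_nbhs.
  have [S [BS Sx oS SC]] := basis_nbhs Bb xC.
  exists S => _; split=> //; apply: subset_trans CU.
  by rewrite (closure_id C).1 //; exact: closureS.
have [V [I [In If Iu]]] := @openly_generated_meet_finite R lambda nu X code B F
  lr nur wn ln XC co lk (fun i inu => (FE i inu).1).
have [x Ix] := meet_finite_closure XC.1 If.
have [phi [phiI phim]] := unbounded_enum nur In Iu.
exists phi; first by split=> [i /phiI/In|].
exists (f x) => i inu; apply: (FE _ (In _ (phiI _ inu))).2.
by apply: Ix; exact: phiI.
Qed.

(** * Weight and pi-character *)

Lemma omega_ord : is_ordinal omega.
Proof.
pose N n : zset := \pi_zset (iter n tree_succ (Tree (of_void tree))).
have N0 : elts (N 0) = set0.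
  by rewrite /N /= elts_pi; apply/seteqP; split=> // x [[]].
have NS n : elts (N n.+1) = elts (N n) `|` [set N n] by exact: elts_tree_succ.
have oN n : is_ordinal (N n).
  elim: n => [|n [tn ttn]].
    by split=> x; rewrite N0.
  split=> [x|x]; rewrite ?NS.
    move=> [xn|->] y yx; last by left.
    by left; exact: (tn x).
  by move=> [/ttn//|->].
have oE : elts omega = range N by rewrite /omega elts_pi.
split=> [x|x]; rewrite oE => -[n _ <-]; last by have [] := oN n.
elim: n => [|n IH] y; first by rewrite N0.
by rewrite NS => -[/IH//|->]; exists n.
Qed.

Lemma omega_mem (lambda mu : zset) : is_cardinal lambda -> infinite_cardinal mu ->
  mu ∈ lambda -> omega ∈ lambda.
Proof.
move=> [ol cl] [_ imu] ml; apply: ord_nsub ol _ => //; first exact: omega_ord.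
move=> /subset_card_le lo; have [_] := cl _ ml; apply.
apply: card_le_trans lo (card_le_trans (card_eq_leW card_omega) _).
exact: card_nat_le.
Qed.

Lemma coded_basis_le (X Y : topologicalType) (f : X -> Y) (code : X -> zset)
    (M : set zset) : is_coding code -> range f = setT ->
  [set G : set Y | coded_in code M (f @^-1` G)] #<= M.
Proof.
move=> /encoding_exists[enc [dec [encE encK]]] fs.
apply: (card_le_map (f := fun G => enc (f @^-1` G))) => [G /=|G H _ _].
  by move=> /(coded_inE _ _ encE).
move=> /(can_inj encK) GH; apply/seteqP; split=> y.
  have [x _ <-] : range f y by rewrite fs.
  by move=> Gx; have : (f @^-1` G) x by []; rewrite GH.
have [x _ <-] : range f y by rewrite fs.
by move=> Gx; have : (f @^-1` H) x by []; rewrite -GH.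
Qed.

Lemma weight_exists (X Y : topologicalType) (f : X -> Y) (code : X -> zset) :
  is_coding code -> range f = setT -> exists w, is_weight Y w.
Proof.
move=> /[dup] co [_ [x0 x0E]] fs; apply: least_cardinal_exists.
have sP := small_powerset (small_elts x0).
have [k ck kE] := cardinal_equipotent (small_setU (small_elts omega) sP).
have kle A : A `<=` elts omega `|` [set z | elts z `<=` elts x0] -> A #<= elts k.
  move=> /subset_card_le H; apply: card_le_trans H _.
  exact: card_eq_leW (card_esym kE).
exists k.
  split=> //; apply: card_le_infinite omega_infinite.
  by apply: kle => x; left.
exists [set G : set Y | open G /\ G !=set0].
  split=> [|U []//]; split=> [U []//|y N]; rewrite nbhsE => -[U [oU Uy] UN].
  by exists U => //; split=> //; split=> //; exists y.
apply: card_le_trans (card_le_trans (coded_basis_le _ co fs) (kle _ (@subsetUr _ _ _))).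
apply: subset_card_le => G _; have [enc [_ [encE _]]] := encoding_exists co.
exists (enc (f @^-1` G)) => //=; rewrite (encE _ : elts _ = _) x0E.
by move=> _ [x _ <-]; exists x.
Qed.

Lemma ne_basis_local_pi_base (Y : topologicalType) (B : set (set Y)) (p : Y) :
  ne_basis B -> local_pi_base p B.
Proof.
move=> [[Bo Bb] B0]; split=> [U BU|N /Bb[U [BU Up] UN]]; last by exists U.
by split; [exact: Bo|exact: B0].
Qed.

Lemma pi_character_exists (Y : topologicalType) (w : zset) : is_weight Y w ->
  exists chi, [/\ is_pi_character Y chi, elts chi `<=` elts w &
    forall p : Y, exists2 P, local_pi_base p P & P #<= elts chi].
Proof.
move=> [iw [B nB Bw] _].
have Bp (p : Y) : exists2 B, local_pi_base p B & B #<= elts w.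
  by exists B => //; exact: ne_basis_local_pi_base.
have wb (p : Y) chi : is_pi_character_at p chi -> elts chi `<=` elts w.
  by case=> _ _; apply.
have [|chi chiE] := @least_cardinal_exists (fun mu =>
    forall (p : Y) chi, is_pi_character_at p chi -> elts chi `<=` elts mu).
  by exists w.
exists chi; split=> //; first by case: chiE => _ _; apply.
move=> p; have [|c /[dup] cp [_ [P pP Pc] _]] := @least_cardinal_exists
    (fun mu => exists2 B : set (set Y), local_pi_base p B & B #<= elts mu).
  by exists w.
exists P => //; apply: card_le_trans Pc _; apply: subset_card_le.
by case: chiE => _ H _; exact: H cp.
Qed.

(** The added operations supply the hypotheses of [family_image_base]. As mu is included in M, each
    chosen local pi-base lies in M as a subset. *)
Lemma adic_submodel_basis (R : realType) (lambda mu : zset) (Y : topologicalType) :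
  compactum Y -> adic R lambda omega Y -> is_ordinal lambda ->
  infinite_set (elts mu) ->
  (forall p : Y, exists2 P, local_pi_base p P & P #<= elts mu) ->
  exists (D : set zset) (b : zset) (op : nat -> seq zset -> zset),
    [/\ elts mu `<=` D, elts lambda `<=` D, D b &
      forall M, elem_submodel M D b -> closed_ops D op M -> elts mu `<=` M ->
        good_trace lambda M -> exists2 BB : set (set Y), ne_basis BB & BB #<= M].
Proof.
move=> YC [X [XC [code co [B lk]] [f cf fs]]] ol imu pib.
have [X' [cX' fX' irr]] := irreducible_restriction XC YC cf fs.
have [[Bb _] _] := lk.
have [enc [dec [encE encK]]] := encoding_exists co.
have [z0 z0E] := small_setU (small_elts mu) (small_elts lambda).
have [D [b [Dcode Dz0 Db base]]] := @lk_base_submodels R lambda z0 X code B co lk.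
have Denc S : D (enc S) by exact: Dcode (encE S).
have fW W : open W -> W !=set0 -> exists2 x, X' x & (f @^-1` W) x.
  move=> oW [y Wy]; have [x X'x fx] : (f @` X') y by rewrite fX'.
  by exists x => //=; rewrite fx.
have [pt ptE] : {pt : set X -> set X & forall S, (exists2 x, X' x & S x) ->
    exists x, [/\ X' x, S x & pt S = [set x]]}.
  apply: (@choice _ _ (fun S P => (exists2 x, X' x & S x) ->
    exists x, [/\ X' x, S x & P = [set x]])) => S.
  have [[x X'x Sx]|] := pselect (exists2 x, X' x & S x); last by exists S.
  by exists [set x] => _; exists x.
(* [pb S] enumerates a local pi-base at some point p with f^-1(p) included in S *)
have [pb pbE] : {pb : set X -> zset -> set Y & forall G : set Y, G !=set0 ->
    exists2 p, G p & exists2 P, local_pi_base p P &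
      forall W, P W -> exists2 a, a ∈ mu & pb (f @^-1` G) a = W}.
  have [e eE] : {e : Y -> zset -> set Y & forall p, exists2 P, local_pi_base p P &
      forall W, P W -> exists2 a, a ∈ mu & e p a = W}.
    apply: (@choice _ _ (fun p e => exists2 P, local_pi_base p P &
      forall W, P W -> exists2 a, a ∈ mu & e a = W)) => p.
    have [P pP /(card_le_mapE omega)[g [gP gi]]] := pib p.
    have [h hE] : {h : zset -> set Y & forall a, (exists2 W, P W & g W = a) ->
        P (h a) /\ g (h a) = a}.
      apply: (@choice _ _ (fun a W => (exists2 W, P W & g W = a) -> P W /\ g W = a)) => a.
      by have [[W PW gW]|] := pselect (exists2 W, P W & g W = a);
        [exists W|exists set0].
    exists h, P => // W PW; exists (g W); first exact: gP.
    by have [|Ph gh] := hE (g W); [exists W|exact: gi].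
  (* An operation sees only a subset S of X, so the point p is chosen from S; for S = f^-1(G) the
     points of [q S] are those of G, because f is onto. *)
  pose q (S : set X) := [set y | f @^-1` [set y] `<=` S].
  have [c cE] : {c : set X -> zset -> set Y & forall S, q S !=set0 ->
      exists2 p, q S p & c S = e p}.
    apply: (@choice _ _ (fun S c => q S !=set0 -> exists2 p, q S p & c = e p)) => S.
    have [[p Sp]|nS] := pselect (q S !=set0); last by exists (fun=> set0).
    by exists (e p) => _; exists p.
  exists c => G [y Gy]; have [|p Gp ->] := cE (f @^-1` G).
    by exists y => x /= ->.
  exists p; last exact: eE.
  have [x _ fx] : range f p by rewrite fs.
  by have := Gp x fx; rewrite /= fx.
pose extra k (s : seq zset) :=
  let A := dec (nth omega s 0) in let a := nth omega s 1 in
  match k with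
  | 0 => enc (f @^-1` (~` (f @` (X' `\` A))))
  | 1 => enc (pt A)
  | _ => enc (f @^-1` (pb A a))
  end.
have [op opP] := @coded_family X code enc dec D extra XC encE encK Denc.
exists D, b, op; split=> //.
- by move=> x xm; apply: Dz0; rewrite z0E; left.
- by move=> x xl; apply: Dz0; rewrite z0E; right.
move=> M Mel Mop muM Mgt.
have Mb : M b by case: Mel.
have [|Mf Mex] := opP M _ Mop; first by exists b.
set SS := coded_in code M in Mf.
have cE S : SS S <-> M (enc S) by exact: coded_inE.
have MB := base M Mel Mgt.
have main := @family_image_base X Y f X' SS B XC YC cf cX' fX' irr Mf _ _ _ Bb
  (fun U => M_base_sat_open Mf MB).
exists [set G : set Y | [/\ open G, G !=set0 & SS (f @^-1` G)]]; last first.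
  apply: card_le_trans (coded_basis_le M co fs).
  by apply: subset_card_le => G [].
split=> [|U []//]; split=> [U []//|y N yN].
have [|||G [oG Gy GN SG]] := main _ _ _ y N yN.
- move=> E /cE SE; apply/cE; have := Mex 0 [:: enc E].
  by rewrite /extra /= encK; apply.
- move=> G oG G0 /cE SG; have [p Gp [P pP PW]] := pbE _ G0.
  exists p => //; exists P => // W /PW[a am <-]; apply/cE.
  have := Mex 2 [:: enc (f @^-1` G); a]; rewrite /extra /= encK; apply=> //.
  by split=> //; split=> //; exact: muM.
- move=> W oW W0 /cE SW; have [x [X'x Wx ptW]] := ptE _ (fW _ oW W0).
  exists [set x]; split=> [|||]; last by exists x.
  + exact: closed_set1_compactum.
  + by apply/cE; have := Mex 1 [:: enc (f @^-1` W)]; rewrite /extra /= encK ptW; apply.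
  + by move=> _ ->.
- by exists G => //; split=> //; split=> //; exists y.
Qed.

Lemma adic_weight (R : realType) (lambda : zset) (Y : topologicalType) :
  regular_cardinal lambda -> compactum Y -> adic R lambda omega Y ->
  exists w chi : zset,
    [/\ is_weight Y w, is_pi_character Y chi & w = chi \/ w ∈ lambda].
Proof.
move=> lr YC ad; have [[cl _] _] := lr; have ol := cardinal_ord cl.
have [X [_ [code co _] [f _ fs]]] := ad.
have [w wY] := weight_exists co fs.
have [mu [muY muw pib]] := pi_character_exists wY.
exists w, mu; split=> //.
have [imu _ _] := muY; have [cmu fmu] := imu; have omu := cardinal_ord cmu.
have ow : is_ordinal w by case: wY => -[[]].
have [D [b [op [muD lD Db key]]]] := adic_submodel_basis YC ad ol fmu pib.
pose A := elts mu `|` [set b].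
have AD : A `<=` D by move=> x [/muD//|->].
have Ab : A b by right.
have Ai : infinite_set A by apply: card_le_infinite fmu; exact/subset_card_le/subsetUl.
have Amu : A #<= elts mu.
  apply: card_setU_le => //; apply: card_le_trans (card_nat_le fmu).
  by apply: (card_le_map (f := fun=> 0)) => // x y -> ->.
have wle k (BB : set (set Y)) : infinite_cardinal k -> ne_basis BB ->
    BB #<= elts k -> elts w `<=` elts k.
  by move=> ik nBB BBk; case: wY => _ _; apply=> //; exists BB.
(* If lambda is at most mu, a hull of mu contains lambda and has size at most mu, so the weight is
   at most mu. *)
have [lm|nlm] := pselect (elts lambda `<=` elts mu).
  left; have [M [Mel Mop AM MA]] := elem_hull op AD Ab Ai.
  have muM : elts mu `<=` M by move=> x xm; apply: AM; left.
  have sM : small M by apply: card_le_small (small_elts mu) (card_le_trans MA Amu).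
  have [BB nBB BBM] := key M Mel Mop muM
    (good_trace_large ol sM (subset_trans lm muM)).
  apply: elts_inj; apply/seteqP; split=> //.
  by apply: wle nBB _ => //; exact: card_le_trans BBM (card_le_trans MA Amu).
have ml : mu ∈ lambda by exact: ord_nsub.
(* If mu is below lambda, the hull is taken with an ordinal trace d below lambda and size at most
   |d|. *)
right; have [||M [d [Mel Mop AM dl [dE Md]]]] :=
  @elem_trace D A b op lambda lr _ lD AD Ab.
- exact: omega_mem ml.
- by apply: (card_le_lt_trans Amu); case: cl => _; apply.
have od := ord_elt ol dl.
have muM : elts mu `<=` M by move=> x xm; apply: AM; left.
have [BB nBB BBM] := key M Mel Mop muM
  (good_trace_ord ol ol (@subset_refl _ _) od dE Md).
have [k ck kd] := cardinal_equipotent (small_elts d).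
have wk : elts w `<=` elts k.
  apply: wle nBB _.
    split=> //; apply: card_le_infinite fmu.
    apply: card_le_trans (subset_card_le muM) _.
    exact: card_le_trans Md (card_eq_leW (card_esym kd)).
  apply: card_le_trans BBM _.
  exact: card_le_trans Md (card_eq_leW (card_esym kd)).
(* Otherwise lambda would embed in w, hence in k and in d, although d is below the cardinal
   lambda. *)
apply: ord_nsub => // /subset_card_le lw; have [_ /(_ _ dl)[_]] := cl; apply.
apply: card_le_trans lw _; apply: card_le_trans (subset_card_le wk) _.
exact: card_eq_leW.
Qed.

Theorem theorem4p10 (R : realType) (lambda : zset) (Y : topologicalType) :
  regular_cardinal lambda ->
  compactum Y ->
  adic R lambda omega Y ->
  (exists w chi : zset,
     [/\ is_weight Y w, is_pi_character Y chi & w = chi \/ w ∈ lambda]) /\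
  (forall nu : zset,
     regular_cardinal nu -> omega ∈ nu -> elts lambda `<=` elts nu ->
     is_caliber Y nu).
Proof.
move=> lr YC ad; split=> [|nu]; first exact: adic_weight YC ad.
exact: adic_caliber ad.
Qed.
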